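(* Let $W=\sum_{i=1}^n\mathbb{I}_i$ be the sum of $n$ independent indicator random variables with $P(\mathbb{I}_i=1)=p_i=1-q_i$, and let $M,\delta,p,q,\alpha$, $Y_1,Y_2$, $\mathrm{BCP}$, $\widehat T,\theta_2,\sigma^2,\tau$ be as defined in the context. If $\theta_2<1/2$ and $\sigma^2>3\tau$, then $$\|\mathcal{L}(W)-\mathrm{BCP}\|_{TV}\le\frac{2}{1-2\theta_2}\bigg\{\frac{4}{pq\widehat T(\sigma^2-3\tau)}\Big(\sum_{i=1}^np_i^4-p\sum_{i=1}^np_i^3\Big)+\delta p^2+P(W>\widehat T)+P(Y_1+Y_2>\widehat T)\bigg\}.$$
   Context: Total variation norm: for a finite signed measure $\nu$ on $\mathbb{Z}$, $\|\nu\|_{TV}=\sum_{k\in\mathbb{Z}}|\nu\{k\}|$ (twice the usual total variation metric for differences of probability laws). $\mathcal{L}(X)$ is the law of $X$. Not all $p_i$ are zero. Parameters: $M=\big\lfloor(\sum_{i=1}^np_i^2)^3(\sum_{i=1}^np_i^3)^{-2}\big\rfloor$, $\ \delta=(\sum_{i=1}^np_i^2)^3(\sum_{i=1}^np_i^3)^{-2}-M\in[0,1)$, $\ p=(\sum_{i=1}^np_i^3)(\sum_{i=1}^np_i^2)^{-1}$ (assumed $0<p<1$), $\ \alpha=\sum_{i=1}^np_i-Mp$, $\ q=1-p$. $\mathrm{BCP}$ denotes the law of $Y_1+Y_2$ with $Y_1$ Poisson with mean $\alpha$ and $Y_2\sim Bi(M,p)$ independent, i.e. the law with probability generating function $(q+pz)^M\exp\{\alpha(z-1)\}$.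 $\widehat T=\lfloor M+\alpha/p\rfloor$, $\ \theta_2=\dfrac{\alpha}{q\widehat T}$, $\ \sigma^2=\sum_{i=1}^np_iq_i$, $\ \tau=\max_ip_iq_i$. *)

(* Defs.v *)
From HB Require Import structures.
From mathcomp Require Import all_boot all_order all_algebra.
From mathcomp Require Import all_classical all_reals all_analysis.

Set Implicit Arguments.
Unset Strict Implicit.
Unset Printing Implicit Defensive.

Import Order.TTheory GRing.Theory Num.Theory.
Import numFieldNormedType.Exports.

Local Open Scope classical_set_scope.
Local Open Scope ring_scope.

HB.instance Definition _ := isPointed.Build int 0.

(* The integers carry the discrete sigma-algebra, as nat does in the library. *)
HB.instance Definition _ := @isMeasurable.Build default_measure_display
  int (discrete_measurable : set (set int)) (@discrete_measurable0 int)
  (@discrete_measurableC int) (@discrete_measurableU int).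

(* No factor 1/2: for a difference of two probability laws this is twice the
   total variation distance. *)
Definition tv_norm (R : realType) (nu : set int -> \bar R) : \bar R :=
  (\esum_(k in [set: int]) `| nu [set k] |)%E.

Definition mutually_independent (R : realType) (d d' : measure_display)
    (T : measurableType d) (T' : measurableType d') (P : probability T R)
    (I : finType) (X : I -> {RV P >-> T'}) : Prop :=
  forall (J : {set I}) (A : I -> set T'),
    (forall i, i \in J -> measurable (A i)) ->
    P [set t | forall i, i \in J -> A i (X i t)] =
    (\prod_(i in J) P (X i @^-1` A i))%E.

Definition independent2 (R : realType) (d d1 d2 : measure_display)
    (T : measurableType d) (T1 : measurableType d1) (T2 : measurableType d2)
    (P : probability T R) (X : {RV P >-> T1}) (Y : {RV P >-> T2}) : Prop :=
  forall (A : set T1) (B : set T2), measurable A -> measurable B ->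
    P (X @^-1` A `&` Y @^-1` B) = (P (X @^-1` A) * P (Y @^-1` B))%E.

Definition indicator_sum (R : realType) (d : measure_display)
    (T : measurableType d) (P : probability T R) (n : nat)
    (Ind : 'I_n -> {RV P >-> bool}) (t : T) : int :=
  \sum_(i < n) (nat_of_bool (Ind i t))%:Z.

Definition sum2 (R : realType) (d : measure_display)
    (T : measurableType d) (P : probability T R)
    (X Y : {RV P >-> nat}) (t : T) : int := (X t)%:Z + (Y t)%:Z.

Definition power_sum (R : realType) (n : nat) (ps : 'I_n -> R) (k : nat) : R :=
  \sum_(i < n) ps i ^+ k.

Definition bcp_ratio (R : realType) (n : nat) (ps : 'I_n -> R) : R :=
  power_sum ps 2 ^+ 3 * (power_sum ps 3 ^+ 2)^-1.

(* [Num.truncn] is the floor, as a nat, of a nonnegative real; the ratio is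
   nonnegative when all the [ps i] are. *)
Definition bcp_M (R : realType) (n : nat) (ps : 'I_n -> R) : nat :=
  Num.truncn (bcp_ratio ps).

Definition bcp_delta (R : realType) (n : nat) (ps : 'I_n -> R) : R :=
  bcp_ratio ps - (bcp_M ps)%:R.

Definition bcp_p (R : realType) (n : nat) (ps : 'I_n -> R) : R :=
  power_sum ps 3 * (power_sum ps 2)^-1.

Definition bcp_q (R : realType) (n : nat) (ps : 'I_n -> R) : R := 1 - bcp_p ps.

Definition bcp_alpha (R : realType) (n : nat) (ps : 'I_n -> R) : R :=
  \sum_(i < n) ps i - (bcp_M ps)%:R * bcp_p ps.

Definition bcp_That (R : realType) (n : nat) (ps : 'I_n -> R) : int :=
  Num.floor ((bcp_M ps)%:R + bcp_alpha ps / bcp_p ps).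

Definition bcp_theta2 (R : realType) (n : nat) (ps : 'I_n -> R) : R :=
  bcp_alpha ps / (bcp_q ps * (bcp_That ps)%:~R).

Definition bcp_sigma2 (R : realType) (n : nat) (ps : 'I_n -> R) : R :=
  \sum_(i < n) ps i * (1 - ps i).

(* The default value 0 is immaterial: the family is nonempty and its terms are
   nonnegative as soon as the [ps i] are probabilities, not all zero. *)
Definition bcp_tau (R : realType) (n : nat) (ps : 'I_n -> R) : R :=
  \big[Num.max/0]_(i < n) (ps i * (1 - ps i)).

(* Main.v *)
Require Import Defs.
From HB Require Import structures.
From mathcomp Require Import all_boot all_order all_algebra.
From mathcomp Require Import all_classical all_reals all_analysis.
From mathcomp Require Import ring lra zify.

Import Order.TTheory GRing.Theory Num.Theory.
Import numFieldNormedType.Exports.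

Local Open Scope classical_set_scope.
Local Open Scope ring_scope.

(* Stein's method by perturbation. Put [N = That] and [Z = z - 1]. The law BCP
   is annihilated by the operator
     A g(k) = p (M + alpha / p - k) g(k + 1) - q k g(k) + alpha p Dg(k + 1),
   where [D] is the forward difference; without its last term, [A] is the
   operator of a birth-death chain on [0, N] of pseudo-binomial type, whose
   Stein solutions satisfy [|Dg| <= min(2, 2 / (p q N))]. The last term costs
   at most [2 theta2] times the distance itself, which can be absorbed. It
   remains to bound [E A g(W)]. With [G = prod_i (1 + p_i Z)] the generating
   function of [W], the choice of the parameters yields the identity
     S1 G - (q + p z) G' + alpha p Z G
       = delta p^2 Z G + Z^3 sum_(i, j) c_ij G / ((1 + p_i Z) (1 + p_j Z))
   with [c_ij >= 0] of sum [S4 - p S3]. Finally, for a Bernoulli sum [U] of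
   variance [s], a score function argument gives [|E Dh(U)| <= sqrt (2 / s)]
   when [|h| <= 1]; splitting a Bernoulli sum into two nearly balanced halves
   then bounds second differences. *)

(** * Polynomials acting by shifts *)

Section PolyAction.
Variable R : comNzRingType.
Implicit Types (G H : {poly R}) (f : nat -> R) (c : R) (x : nat).

(* ['X] acts as the shift, so a probability generating function [G] acts as
   [f |-> E f(x + W)] and ['X - 1] as the forward difference. *)
Definition act G f x : R := \sum_(k < size G) G`_k * f (x + k)%N.

Lemma act_wide G f x m : (size G <= m)%N ->
  act G f x = \sum_(k < m) G`_k * f (x + k)%N.
Proof.
move=> Gm; rewrite /act (big_ord_widen m (fun k => G`_k * f (x + k)%N)) //.
rewrite big_mkcond /=; apply: eq_bigr => k _; case: ltnP => // Gk.
by rewrite nth_default // mul0r.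
Qed.

Lemma actD G H f x : act (G + H) f x = act G f x + act H f x.
Proof.
pose m := maxn (size G) (size H).
rewrite !(act_wide _ f x m) ?leq_maxl ?leq_maxr ?size_polyD //.
by rewrite -big_split /=; apply: eq_bigr => k _; rewrite coefD mulrDl.
Qed.

Lemma actC c f x : act c%:P f x = c * f x.
Proof.
by rewrite (act_wide _ _ _ _ (size_polyC_leq1 c)) big_ord1 coefC eqxx addn0.
Qed.

Lemma act0 f x : act 0 f x = 0.
Proof. by rewrite /act size_poly0 big_ord0. Qed.

Lemma actXM G f x : act ('X * G) f x = act G f x.+1.
Proof.
have sXG : (size ('X * G)%R <= (size G).+1)%N.
  by apply: leq_trans (size_polyMleq _ _) _; rewrite size_polyX.
rewrite (act_wide _ _ _ _ sXG) big_ord_recl coefXM eqxx mul0r add0r.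
by apply: eq_bigr => k _; rewrite coefXM /= addSnnS.
Qed.

Lemma actCM c G f x : act (c%:P * G) f x = c * act G f x.
Proof.
have scG : (size (c%:P * G)%R <= size G)%N by rewrite mul_polyC size_scale_leq.
rewrite (act_wide _ _ _ _ scG) mulr_sumr; apply: eq_bigr => k _.
by rewrite coefCM mulrA.
Qed.

Lemma actN G f x : act (- G) f x = - act G f x.
Proof. by have -> : - G = (-1)%:P * G; rewrite ?actCM ?polyCN !mulN1r. Qed.

Lemma actB G H f x : act (G - H) f x = act G f x - act H f x.
Proof. by rewrite actD actN. Qed.

Lemma act_sum (I : Type) (r : seq I) (Q : pred I) (F : I -> {poly R}) f x :
  act (\sum_(i <- r | Q i) F i) f x = \sum_(i <- r | Q i) act (F i) f x.
Proof. by apply: (big_morph (fun G => act G f x)) => [G H|]; rewrite ?actD ?act0. Qed.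

Lemma eq_act G f g x : f =1 g -> act G f x = act G g x.
Proof. by move=> fg; apply: eq_bigr => k _; rewrite fg. Qed.

Lemma act_shift G f x y : act G (fun z => f (y + z)%N) x = act G f (y + x)%N.
Proof. by apply: eq_bigr => k _; rewrite addnA. Qed.

(** Constants act as scalars and ['X] as the shift, so products act by composition: independent
    summands are averaged one after the other. *)
Lemma actM G H f x : act (G * H) f x = act G (act H f) x.
Proof.
elim/poly_ind: G x => [|G c IHG] x; first by rewrite mul0r !act0.
have -> : (G * 'X + c%:P) * H = 'X * (G * H) + c%:P * H by ring.
by rewrite (mulrC G 'X) !actD !actXM actCM actC IHG.
Qed.

Lemma act_deriv G f :
  act ('X * G^`()) f 0 = \sum_(k < size G) G`_k * (k%:R * f k).
Proof.
have sG' : (size (G^`())%R <= size G)%N.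
  by rewrite (leq_trans (size_poly _ _)) // leq_pred.
rewrite actXM (act_wide _ _ _ _ sG').
transitivity (\sum_(k < (size G).+1) G`_k * (k%:R * f k)).
  rewrite big_ord_recl mul0r mulr0 add0r; apply: eq_bigr => k _ /=.
  by rewrite coef_deriv add1n mulr_natl mulrnAl mulrnAr.
by rewrite big_ord_recr /= [G`__]nth_default // mul0r addr0.
Qed.

End PolyAction.

Arguments act {R}.

Section BernoulliSums.
Variable R : comNzRingType.
Implicit Types (p : R) (f h : nat -> R) (s : seq R).

(** Generating function of a Bernoulli variable of mean [p], written in ['X - 1] so that expansions
    in differences become ring identities. *)
Definition bern p : {poly R} := 1 + p%:P * ('X - 1).

Lemma act_bern p f x : act (bern p) f x = (1 - p) * f x + p * f x.+1.
Proof.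
rewrite /bern -[X in X - _]mulr1 actD actCM actB actXM -!polyC1 !actC; ring.
Qed.
End BernoulliSums.

Arguments bern {R}.

(** * Smoothness of Bernoulli sums *)

Section Smoothing.
Variable R : realFieldType.
Implicit Types (p K : R) (s : seq R) (h k : nat -> R) (u : nat).

Definition pgf s : {poly R} := \prod_(p <- s) bern p.
Definition variance s : R := \sum_(p <- s) p * (1 - p).
Definition probs s := all (fun p => 0 <= p <= 1) s.

(* [walk s F a b u] is the expectation of [F (a + A) (b + B) (u + U)], where,
   for independent Bernoulli variables [I_i] of means [p_i] and
   [xi_i = I_i - p_i], [A], [B] and [U] are the sums of the [xi_i], of the
   [(2 p_i - 1) xi_i] and of the [I_i]. *)
Fixpoint walk s (F : R -> R -> nat -> R) a b u : R :=
  if s is p :: s' then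
    (1 - p) * walk s' F (a - p) (b - (2 * p - 1) * p) u +
    p * walk s' F (a + (1 - p)) (b + (2 * p - 1) * (1 - p)) u.+1
  else F a b u.

Lemma pgf_cons p s : pgf (p :: s) = bern p * pgf s.
Proof. by rewrite /pgf big_cons. Qed.

Lemma variance_cons p s : variance (p :: s) = p * (1 - p) + variance s.
Proof. by rewrite /variance big_cons. Qed.

Lemma act_pgf_cons p s h u :
  act (pgf (p :: s)) h u = (1 - p) * act (pgf s) h u + p * act (pgf s) h u.+1.
Proof. by rewrite pgf_cons actM act_bern. Qed.

(** Jensen's inequality: at each step the convexity gap is the variance [p * (1 - p) * (x - y) ^+ 2]
    of a two-point law. *)
Lemma walk_sqr s F a b u : probs s ->
  walk s F a b u ^+ 2 <= walk s (fun a b u => F a b u ^+ 2) a b u.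
Proof.
elim: s a b u => [|p s IHs] a b u //= /andP[/andP[p0 p1] ps].
set x := walk s F _ _ _; set y := walk s F _ _ _.
have hx := IHs (a - p) (b - (2 * p - 1) * p) u ps.
have hy := IHs (a + (1 - p)) (b + (2 * p - 1) * (1 - p)) u.+1 ps.
rewrite -/x in hx; rewrite -/y in hy.
have := ler_wpM2l p0 hy; have := ler_wpM2l (_ : 0 <= 1 - p) hx.
rewrite subr_ge0 => /(_ p1) h1 h2.
apply: le_trans (lerD h1 h2).
rewrite -subr_ge0 (_ : _ - _ = p * (1 - p) * (x - y) ^+ 2); last by ring.
by rewrite mulr_ge0 ?sqr_ge0 ?mulr_ge0 ?subr_ge0.
Qed.

Lemma le_walk s F F' a b u : probs s ->
  (forall a b u, F a b u <= F' a b u) -> walk s F a b u <= walk s F' a b u.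
Proof.
move=> + FF'; elim: s a b u => [|p s IHs] a b u //= /andP[/andP[p0 p1] ps].
by rewrite lerD // ler_wpM2l ?subr_ge0 ?IHs.
Qed.

(** The increments are centred, and one step adds [p * (1 - p) * (1 + (2 * p - 1) ^+ 2)], which is
    at most [2 * p * (1 - p)]. *)
Lemma walk_second_moments s a b u : probs s ->
  walk s (fun a b _ => a ^+ 2 + b ^+ 2) a b u <= a ^+ 2 + b ^+ 2 + 2 * variance s.
Proof.
elim: s a b u => [|p s IHs] a b u /=; first by rewrite /variance big_nil; lra.
move=> /andP[/andP[p0 p1] ps]; rewrite variance_cons.
have h1 := ler_wpM2l p0 (IHs (a + (1 - p)) (b + (2 * p - 1) * (1 - p)) u.+1 ps).
have q0 : 0 <= 1 - p by rewrite subr_ge0.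
have h0 := ler_wpM2l q0 (IHs (a - p) (b - (2 * p - 1) * p) u ps).
apply: le_trans (lerD h0 h1) _.
rewrite -subr_ge0 (_ : _ - _ = (p * (1 - p)) * (4 * (p * (1 - p)))); last by ring.
by rewrite !mulr_ge0.
Qed.

(* Integrating [xi_i] against [I_i] turns [(1 - p_i) h(U) + p_i h(U + 1)] into
   [p_i (1 - p_i)] times the full expectation of [h(U + 1) - h(U)]; summing
   over [i] gives this identity. *)
Lemma walk_score s h a b u :
  walk s (fun a b u => a * ((h u + h u.+1) / 2) + b * ((h u.+1 - h u) / 2)) a b u
  = a * ((act (pgf s) h u + act (pgf s) h u.+1) / 2)
    + b * ((act (pgf s) h u.+1 - act (pgf s) h u) / 2)
    + variance s * (act (pgf s) h u.+1 - act (pgf s) h u).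
Proof.
elim: s a b u => [|p s IHs] a b u.
  by rewrite /pgf /variance !big_nil -polyC1 !actC !mul1r mul0r addr0.
rewrite /= !IHs variance_cons !act_pgf_cons.
by field.
Qed.

Lemma act_diff s h u : act (pgf s * ('X - 1)) h u =
  act (pgf s) h u.+1 - act (pgf s) h u.
Proof. by rewrite mulrC mulrBl mul1r actB actXM. Qed.

(** By [walk_score], the difference times the variance is the mean of a score paired with values of
    [h]. Squaring with [walk_sqr] leaves the second moments of the score, at most [2 * variance s],
    and one factor of the variance cancels. *)
Lemma diff_bound s B h u : probs s -> (forall x, h x ^+ 2 <= B) ->
  variance s * act (pgf s * ('X - 1)) h u ^+ 2 <= 2 * B.
Proof.
move=> ps hB; have B0 : 0 <= B by rewrite (le_trans _ (hB 0%N)) ?sqr_ge0.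
have v0 : 0 <= variance s.
  rewrite /variance big_seq sumr_ge0 // => p /(allP ps) /andP[p0 p1].
  by rewrite mulr_ge0 ?subr_ge0.
rewrite act_diff; set D := _ - _.
have [v_eq0|v_neq0] := eqVneq (variance s) 0.
  by rewrite v_eq0 mul0r mulr_ge0.
have v_gt0 : 0 < variance s by rewrite lt_neqAle eq_sym v_neq0.
rewrite -(ler_pM2l v_gt0).
have -> : variance s * (variance s * D ^+ 2) = (variance s * D) ^+ 2 by ring.
have -> : variance s * D = walk s
  (fun a b u => a * ((h u + h u.+1) / 2) + b * ((h u.+1 - h u) / 2)) 0 0 u.
  by rewrite walk_score !mul0r !add0r.
apply: le_trans (walk_sqr _ _ _ _ _ ps) _.
have step a b x : (a * ((h x + h x.+1) / 2) + b * ((h x.+1 - h x) / 2)) ^+ 2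
    <= B * (a ^+ 2 + b ^+ 2).
  (* The squares of the half sum and the half difference add up to the mean of the two squares. *)
  have hc : ((h x + h x.+1) / 2) ^+ 2 + ((h x.+1 - h x) / 2) ^+ 2 <= B.
    have -> : ((h x + h x.+1) / 2) ^+ 2 + ((h x.+1 - h x) / 2) ^+ 2 =
      (h x ^+ 2 + h x.+1 ^+ 2) / 2 by field.
    have := hB x; have := hB x.+1; lra.
  set c := (h x + h x.+1) / 2 in hc *; set e := (h x.+1 - h x) / 2 in hc *.
  have /(ler_wpM2r (_ : 0 <= a ^+ 2 + b ^+ 2)) : c ^+ 2 + e ^+ 2 <= B by [].
  rewrite addr_ge0 ?sqr_ge0 // => /(_ isT); apply: le_trans.
  (* Lagrange's identity gives Cauchy-Schwarz for the pairs [(a, b)] and [(c, e)]. *)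
  rewrite -subr_ge0 (_ : _ - _ = (a * e - b * c) ^+ 2) ?sqr_ge0 //.
  by ring.
apply: le_trans (le_walk _ _ _ _ _ _ ps step) _.
have walkZ a b x : walk s (fun a b _ => B * (a ^+ 2 + b ^+ 2)) a b x =
    B * walk s (fun a b _ => a ^+ 2 + b ^+ 2) a b x.
  by elim: (s) a b x => [|p s' IH] a b x //=; rewrite !IH; ring.
rewrite walkZ.
have := ler_wpM2l B0 (walk_second_moments _ 0 0 u ps).
rewrite expr0n /= !add0r; move/le_trans; apply.
by rewrite le_eqVlt; apply/orP; left; apply/eqP; ring.
Qed.

(** Greedy allocation: each new element joins the half of smaller variance, so the signed gap never
    leaves [[- tau, tau]]. *)
Lemma variance_split tau s : 0 <= tau -> probs s ->
  (forall p, p \in s -> p * (1 - p) <= tau) ->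
  exists s1 s2, perm_eq s (s1 ++ s2) /\ `|variance s1 - variance s2| <= tau.
Proof.
move=> tau0; elim: s => [|p s IHs] /=.
  by move=> _ _; exists [::], [::]; rewrite /variance !big_nil subrr normr0.
move=> /andP[/andP[p0 p1] ps] ht.
have /IHs /(_ _)[|s1 [s2 [ss12 hv]]] := ps.
  by move=> x xs; rewrite ht // inE xs orbT.
have pt : p * (1 - p) <= tau by rewrite ht ?mem_head.
have pq0 : 0 <= p * (1 - p) by rewrite mulr_ge0 ?subr_ge0.
move: hv; rewrite ler_norml => /andP[hv1 hv2].
have [le12|/ltW le21] := lerP (variance s1) (variance s2).
  exists (p :: s1), s2; rewrite /= perm_cons; split => //.
  by rewrite variance_cons ler_norml; apply/andP; split; lra.
exists s1, (p :: s2); split; first by rewrite perm_sym perm_catC /= perm_cons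
  perm_catC perm_sym.
by rewrite variance_cons ler_norml; apply/andP; split; lra.
Qed.

(** The sum splits into two independent parts of variance at least [(variance s - tau) / 2] each,
    and each part absorbs one difference through [diff_bound]. *)
Lemma second_diff_bound tau s K k u : 0 <= tau -> probs s ->
  (forall p, p \in s -> p * (1 - p) <= tau) -> tau < variance s ->
  (forall x, `|k x| <= K) ->
  `|act (pgf s * ('X - 1) ^+ 2) k u| <= 4 * K / (variance s - tau).
Proof.
move=> tau0 ps ht hv hK; have K0 : 0 <= K by rewrite (le_trans _ (hK 0%N)).
have [s1 [s2 [ss12]]] := variance_split _ _ tau0 ps ht.
have := ps; rewrite /probs (perm_all _ ss12) all_cat => /andP[ps1 ps2].
have -> : pgf s * ('X - 1) ^+ 2 = (pgf s1 * ('X - 1)) * (pgf s2 * ('X - 1)).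
  by rewrite /pgf (perm_big _ ss12) big_cat /=; ring.
have ev : variance s = variance s1 + variance s2.
  by rewrite /variance (perm_big _ ss12) big_cat.
move: hv; rewrite {}ev.
set v1 := variance s1; set v2 := variance s2 => hv.
rewrite ler_norml => /andP[d1 d2].
set v := v1 + v2 - tau.
have v_gt0 : 0 < v by rewrite /v; lra.
have hv1 : v / 2 <= v1 by rewrite /v; lra.
have hv2 : v / 2 <= v2 by rewrite /v; lra.
rewrite actM.
set h := act (pgf s2 * _) k.
have v2_gt0 : 0 < v2 by lra.
have hh x : h x ^+ 2 <= 2 * K ^+ 2 / v2.
  rewrite ler_pdivlMr // mulrC diff_bound // => y.
  by rewrite -real_normK ?num_real // ler_sqr ?nnegrE.
have := diff_bound _ _ _ u ps1 hh; rewrite -/v1; set D := act _ _ _ => hD.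
rewrite -(ler_sqr (x := `|D|)) ?nnegrE ?divr_ge0 ?mulr_ge0 ?(ltW v_gt0) //.
rewrite real_normK ?num_real // expr_div_n ler_pdivlMr ?exprn_gt0 //.
(* Two uses of [diff_bound] give [v1 * v2 * D ^+ 2 <= 4 * K ^+ 2]; this turns it into
   [v ^+ 2 * D ^+ 2 <= 16 * K ^+ 2]. *)
have h4 : v ^+ 2 <= 4 * (v1 * v2).
  have := ler_pM _ _ hv1 hv2; rewrite divr_ge0 ?(ltW v_gt0) // => /(_ isT isT).
  by rewrite expr2; lra.
apply: le_trans (ler_wpM2l (sqr_ge0 D) h4) _.
have := ler_wpM2l (ltW v2_gt0) hD.
rewrite (_ : v2 * (2 * (2 * K ^+ 2 / v2)) = 4 * K ^+ 2).
  rewrite exprMn; lra.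
by field; rewrite gt_eqF.
Qed.

End Smoothing.

(** * Stein discrepancy of a Bernoulli sum *)

Lemma deriv_prod_uniq (R : comNzRingType) (I : eqType) (r : seq I)
    (F : I -> {poly R}) : uniq r ->
  (\prod_(i <- r) F i)^`() =
  \sum_(i <- r) (F i)^`() * \prod_(j <- r | j != i) F j.
Proof.
elim: r => [|a r IHr] /=; first by rewrite !big_nil -polyC1 derivC.
move=> /andP[ar ur]; rewrite !big_cons derivM eqxx /= IHr // mulr_sumr.
have rem_a : \prod_(j <- r | j != a) F j = \prod_(j <- r) F j.
  rewrite big_seq_cond [RHS]big_seq; apply: eq_bigl => j.
  by have [->|] := eqVneq j a; rewrite ?andbT // (negPf ar).
rewrite rem_a; congr (_ + _); rewrite [LHS]big_seq [RHS]big_seq.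
apply: eq_bigr => i ir; rewrite big_cons.
have [ai|_] := eqVneq a i; first by rewrite ai ir in ar.
by rewrite mulrCA.
Qed.

Section SteinExpansion.
Variables (R : realFieldType) (I : finType) (ps : I -> R).

Let G := \prod_i bern (ps i).
Let G1 i := \prod_(k | k != i) bern (ps k).
Let G2 i j := \prod_(k | (k != i) && (k != j)) bern (ps k).
Let S k := \sum_i ps i ^+ k.
Let Z : {poly R} := 'X - 1.

Let GE i : G = bern (ps i) * G1 i.
Proof. by rewrite /G (bigD1 i). Qed.

Let G1E i j : j != i -> G1 i = bern (ps j) * G2 i j.
Proof. by move=> ji; rewrite /G1 (bigD1 j). Qed.

Let G2C i j : G2 i j = G2 j i.
Proof. by apply: eq_bigl => k; rewrite andbC. Qed.

Lemma deriv_prod_bern : G^`() = \sum_i (ps i)%:P * G1 i.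
Proof.
rewrite /G deriv_prod_uniq ?index_enum_uniq //; apply: eq_bigr => i _.
congr (_ * _).
by rewrite /bern derivD derivM derivB derivX -polyC1 !derivC subr0 mul0r
  !add0r polyC1 mulr1.
Qed.

(** These are the third order weights multiplied by [2 * S 2]. They vanish on the diagonal, where
    [G2 i i] omits one factor instead of two. *)
Let c i j := ps i ^+ 2 * ps j ^+ 2 * (ps i - ps j) ^+ 2.

(** [c] is the symmetrization of [e], whose double sum is [S 4 * S 2 - S 3 * S 3]; the choice of [p]
    turns [S 3 * S 3] into [p * S 2 * S 3]. *)
Lemma sum_coef p : p * S 2 = S 3 ->
  \sum_i \sum_j c i j = 2 * S 2 * (S 4 - p * S 3).
Proof.
move=> hp; pose e i j := ps i ^+ 4 * ps j ^+ 2 - ps i ^+ 3 * ps j ^+ 3.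
have cE i j : c i j = e i j + e j i by rewrite /c /e; ring.
have eE : \sum_i \sum_j e i j = S 4 * S 2 - S 3 * S 3.
  rewrite /S !big_distrlr -sumrB; apply: eq_bigr => i _.
  by rewrite -sumrB.
under eq_bigr => i _ do (under eq_bigr => j _ do rewrite cE); rewrite /=.
under eq_bigr => i _ do rewrite big_split /=.
rewrite big_split /= [X in _ + X]exchange_big /= eE -{2 4}hp; ring.
Qed.

(* Since [sum_i p_i^2 (p_i - p) = 0], the third order weights can be
   antisymmetrized, which gains one more difference and nonnegative
   coefficients. *)
Lemma stein_pgf (p m a d : R) :
  S 2 != 0 -> p * S 2 = S 3 -> a = S 1 - m * p -> d = S 2 - m * p ^+ 2 ->
  (S 1)%:P * G - (1 + p%:P * Z) * G^`() + (a * p)%:P * Z * G =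
  d%:P * (Z * G) +
  Z ^+ 3 * \sum_i \sum_j (c i j / (2 * S 2))%:P * G2 i j.
Proof.
move=> S20 hp -> ->.
have GS (w : I -> R) : \sum_i (w i)%:P * G = (\sum_i w i)%:P * G.
  by rewrite -mulr_suml rmorph_sum.
(* Expanding [S 1] and [S 2] times [G] over single factors reduces the left side to
   [d Z G - Z^2 T]. *)
pose T := \sum_i (ps i ^+ 2 * (ps i - p))%:P * G1 i.
have ZE i : (ps i)%:P * Z * G1 i = G - G1 i by rewrite (GE i) /bern -/Z; ring.
have S1G : (S 1)%:P * G =
    \sum_i (ps i)%:P * G1 i + Z * \sum_i (ps i ^+ 2)%:P * G1 i.
  rewrite /S -GS mulr_sumr -big_split /=; apply: eq_bigr => i _.
  by rewrite expr1 (GE i) /bern -/Z; ring.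
have S2G : (S 2)%:P * G =
    \sum_i (ps i ^+ 2)%:P * G1 i + Z * \sum_i (ps i ^+ 3)%:P * G1 i.
  rewrite /S -GS mulr_sumr -big_split /=; apply: eq_bigr => i _.
  by rewrite (GE i) /bern -/Z; ring.
have TE : T = \sum_i (ps i ^+ 3)%:P * G1 i - p%:P * \sum_i (ps i ^+ 2)%:P * G1 i.
  rewrite mulr_sumr -sumrB; apply: eq_bigr => i _; ring.
(* As [p * S 2 = S 3], the weights of [T] times [S 2] are sums over [j] of terms antisymmetric in
   [i] and [j]. Swapping the indices then produces [G1 i - G1 j = (p_j - p_i) Z G2 i j]. *)
have TZ : (2 * S 2)%:P * T = - (Z * \sum_i \sum_j (c i j)%:P * G2 i j).
  pose t i j := (ps i ^+ 2 * ps j ^+ 2 * (ps i - ps j))%:P * G1 i.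
  have S2T : (S 2)%:P * T = \sum_i \sum_j t i j.
    rewrite mulr_sumr; apply: eq_bigr => i _.
    rewrite -mulr_suml -rmorph_sum /= mulrA -polyCM; congr (_%:P * _).
    rewrite mulrCA mulrBr [S 2 * p]mulrC hp /S mulr_suml -sumrB mulr_sumr.
    by apply: eq_bigr => j _; ring.
  rewrite mulr_natl mulr2n polyCD mulrDl S2T.
  rewrite [X in _ + X]exchange_big /= -big_split mulr_sumr -sumrN.
  apply: eq_bigr => i _; rewrite -big_split mulr_sumr -sumrN.
  apply: eq_bigr => j _ /=; rewrite /t /c.
  have [->|ij] := eqVneq i j; first by rewrite subrr; ring.
  rewrite (G1E _ _ ij) [G1 i](G1E i j) 1?eq_sym // (G2C j i) /bern -/Z; ring.
have -> : \sum_i \sum_j (c i j / (2 * S 2))%:P * G2 i j =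
    ((2 * S 2)^-1)%:P * \sum_i \sum_j (c i j)%:P * G2 i j.
  rewrite [RHS]mulr_sumr; apply: eq_bigr => i _; rewrite [RHS]mulr_sumr.
  by apply: eq_bigr => j _; rewrite mulrC polyCM; ring.
have ZT : Z * (((2 * S 2)^-1)%:P * \sum_i \sum_j (c i j)%:P * G2 i j) = - T.
  have u : (2 * S 2)^-1 * (2 * S 2) = 1 by rewrite mulVf // mulf_neq0 ?pnatr_eq0.
  by rewrite mulrCA -[Z * _]opprK -TZ mulrN mulrA -polyCM u mul1r.
have Z3 W : Z ^+ 3 * W = Z * (Z * (Z * W)) by ring.
rewrite Z3 ZT deriv_prod_bern.
move: S1G S2G TE.
set A1 := \sum_i (ps i)%:P * G1 i; set A2 := \sum_i (ps i ^+ 2)%:P * G1 i.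
set A3 := \sum_i (ps i ^+ 3)%:P * G1 i => S1G S2G ->.
rewrite (_ : (S 1)%:P * G - _ + _ = (S 1)%:P * G - (1 + p%:P * Z) * A1
    + p%:P * Z * ((S 1)%:P * G) - (m * p ^+ 2)%:P * (Z * G)); last first.
  by rewrite !(polyCM, polyCB, expr2); ring.
rewrite (_ : (S 2 - m * p ^+ 2)%:P * (Z * G) =
    Z * ((S 2)%:P * G) - (m * p ^+ 2)%:P * (Z * G)); last first.
  by rewrite polyCB; ring.
by rewrite S1G S2G; ring.
Qed.

Lemma act_pgf_bound s K k x : probs R s -> (forall x, `|k x| <= K) ->
  `|act (pgf R s) k x| <= K.
Proof.
move=> + hK; elim: s x => [|p s IHs] x /=.
  by rewrite /pgf big_nil -polyC1 actC mul1r.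
move=> /andP[/andP[p0 p1] ps']; rewrite act_pgf_cons.
apply: le_trans (ler_normD _ _) _; have q0 : 0 <= 1 - p by rewrite subr_ge0.
rewrite !normrM (ger0_norm p0) (ger0_norm q0).
have := ler_wpM2l p0 (IHs x.+1 ps'); have := ler_wpM2l q0 (IHs x ps'); lra.
Qed.

(** One factor [Z] turns [g] into its first difference, which [L] bounds in the [d] term. In the
    third order term the other two factors are smoothed by the Bernoulli sum without summands [i]
    and [j]: removing these costs at most [2 * tau] of variance, the balanced splitting another
    [tau]. *)
Lemma stein_expectation_bound (p m a d tau K L : R) (g : nat -> R) :
  (forall i, 0 <= ps i <= 1) -> (forall i, ps i * (1 - ps i) <= tau) ->
  0 <= tau -> 3 * tau < \sum_i ps i * (1 - ps i) ->
  0 < S 2 -> p * S 2 = S 3 -> a = S 1 - m * p -> d = S 2 - m * p ^+ 2 ->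
  0 <= d -> (forall x, `|g x.+2 - g x.+1| <= L) ->
  (forall x, `|g x.+2 - g x.+1| <= K) ->
  `|act ('X * ((S 1)%:P * G - (1 + p%:P * Z) * G^`() + (a * p)%:P * Z * G)) g 0|
  <= L * d + K * (4 * (S 4 - p * S 3) / (\sum_i ps i * (1 - ps i) - 3 * tau)).
Proof.
move=> ps01 pstau tau0 hvar S20 hp ha hd d0 hL hg.
have K0 : 0 <= K by rewrite (le_trans _ (hg 0%N)).
have [w0 S2n0] : 0 < 2 * S 2 /\ S 2 != 0 by split; rewrite ?mulr_gt0 ?gt_eqF.
rewrite (stein_pgf p m a d) //.
pose k x := g x.+2 - g x.+1.
have actZ H : act ('X * (Z * H)) g 0 = act H k 0.
  rewrite actXM [Z * H]mulrC actM -(addn0 1%N) -act_shift.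
  by apply: eq_act => y; rewrite /Z actB -polyC1 -['X]mulr1 actXM -polyC1 !actC
    !mul1r add1n.
have -> : 'X * (d%:P * (Z * G)
      + Z ^+ 3 * \sum_i \sum_j (c i j / (2 * S 2))%:P * G2 i j)
    = d%:P * ('X * (Z * G)) + \sum_i \sum_j
      (c i j / (2 * S 2))%:P * ('X * (Z * (G2 i j * Z ^+ 2))).
  rewrite mulrDr mulrCA; congr (_ + _); rewrite !mulr_sumr; apply: eq_bigr => i _.
  by rewrite !mulr_sumr; apply: eq_bigr => j _; ring.
rewrite actD actCM actZ act_sum.
under eq_bigr => i _ do (rewrite act_sum; under eq_bigr => j _ do rewrite actCM actZ).
apply: le_trans (ler_normD _ _) (lerD _ _).
  rewrite normrM (ger0_norm d0) mulrC ler_wpM2r //.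
  rewrite (_ : G = pgf R [seq ps i | i <- index_enum I]); last first.
    by rewrite /pgf big_map.
  by apply: act_pgf_bound hL; apply/allP => _ /mapP[i _ ->].
set v := \sum_i _ - 3 * tau; have v0 : 0 < v by rewrite /v subr_gt0.
have -> : K * (4 * (S 4 - p * S 3) / v) =
    \sum_i \sum_j c i j / (2 * S 2) * (4 * K / v).
  under eq_bigr => i _ do rewrite -mulr_suml -mulr_suml.
  rewrite -mulr_suml -mulr_suml (sum_coef _ hp).
  by field; rewrite S2n0 gt_eqF.
apply: le_trans (ler_norm_sum _ _ _) (ler_sum _ _) => i _.
apply: le_trans (ler_norm_sum _ _ _) (ler_sum _ _) => j _.
have c0 : 0 <= c i j by rewrite /c mulr_ge0 ?sqr_ge0 // mulr_ge0 ?sqr_ge0.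
have cw0 : 0 <= c i j / (2 * S 2) by apply: divr_ge0 (ltW w0).
rewrite normrM (ger0_norm cw0).
have [ij|ij] := eqVneq i j; first by rewrite /c ij subrr expr0n /= !(mulr0, mul0r).
apply: ler_wpM2l => //.
pose s := [seq ps l | l <- index_enum I & (l != i) && (l != j)].
have -> : G2 i j = pgf R s by rewrite /pgf big_map big_filter.
have vs : v <= variance R s - tau.
  rewrite /variance /s big_map big_filter /v (bigD1 i) //= (bigD1 j) 1?eq_sym //=.
  by have := pstau i; have := pstau j; lra.
have /le_trans : `|act (pgf R s * Z ^+ 2) k 0| <= 4 * K / (variance R s - tau).
  apply: second_diff_bound => //.
  - by apply/allP => _ /mapP[l _ ->].
  - by move=> _ /mapP[l _ ->].
  - by rewrite -subr_gt0 (lt_le_trans v0).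
apply; rewrite ler_wpM2l ?mulr_ge0 // lef_pV2 // posrE //.
exact: lt_le_trans vs.
Qed.

End SteinExpansion.

(** * The pseudo-binomial Stein equation *)

(* [w] is the stationary law of the birth-death chain on [0, N] with birth
   rates [a] and death rates [b]. *)
Lemma detailed_balance (R : realFieldType) (N : nat) (a b : nat -> R) :
  (forall j, (j < N)%N -> 0 < a j) -> (forall j, (0 < j <= N)%N -> 0 < b j) ->
  exists w : nat -> R, [/\ forall j, (j <= N)%N -> 0 < w j,
    \sum_(0 <= i < N.+1) w i = 1 &
    forall j, (j < N)%N -> a j * w j = b j.+1 * w j.+1].
Proof.
move=> a0 b0; pose fix v j := if j is j'.+1 then v j' * a j' / b j else 1.
have v0 j : (j <= N)%N -> 0 < v j.
  elim: j => [|j IHj] jN /=; first by rewrite ltr01.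
  by rewrite divr_gt0 ?b0 // mulr_gt0 ?a0 // IHj // ltnW.
pose V := \sum_(0 <= i < N.+1) v i.
have V0 : 0 < V.
  rewrite /V big_nat_recr //= ltr_wpDl ?v0 // big_nat sumr_ge0 // => i.
  by move=> /andP[_ /ltnW/v0/ltW].
exists (fun j => v j / V); split.
- by move=> j jN; rewrite divr_gt0 ?v0.
- by rewrite -mulr_suml divff ?gt_eqF.
- move=> j jN /=; have := b0 j.+1; rewrite jN => /(_ isT) bj.
  by field; rewrite !gt_eqF.
Qed.

(** Summing detailed balance over [i < j] equates a sum of birth flows with a sum of death flows.
    Monotonicity of the rates compares these with [a j] and [b j], gaining [p] on one side and [q]
    on the other, hence the [1]. The upper sums are symmetric. *)
Lemma sum_le_balance (R : realFieldType) (N : nat) (p q : R) (a b w : nat -> R) :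
  0 <= p -> 0 <= q -> p + q = 1 ->
  (forall j, (j <= N)%N -> 0 < w j) ->
  (forall j, (j < N)%N -> a j * w j = b j.+1 * w j.+1) ->
  (forall i j, (i < j <= N)%N -> a j + p <= a i) ->
  (forall i j, (i < j <= N)%N -> b i + q <= b j) ->
  a N = 0 -> b 0%N = 0 ->
  forall j, (0 < j <= N)%N ->
  (a j + 1) * \sum_(0 <= i < j) w i <= b j * (\sum_(0 <= i < j) w i + w j) /\
  (b j + 1) * \sum_(j.+1 <= i < N.+1) w i <=
    a j * (w j + \sum_(j.+1 <= i < N.+1) w i).
Proof.
move=> p0 q0 pq w0 bal am bm aN b0 j /andP[j0 jN].
have wge i : (i <= N)%N -> 0 <= w i by move=> /w0/ltW.
split.
  have : \sum_(0 <= i < j) (a j + p) * w i <= \sum_(0 <= i < j) a i * w i.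
    apply: ler_sum_nat => i /andP[_ ij].
    by rewrite ler_wpM2r ?wge ?am ?ij // (leq_trans (ltnW ij)).
  have -> : \sum_(0 <= i < j) a i * w i = \sum_(0 <= i < j.+1) b i * w i.
    rewrite [RHS]big_nat_recl // b0 mul0r add0r; apply: eq_big_nat => i /andP[_ ij].
    by rewrite bal // (leq_trans ij).
  have : \sum_(0 <= i < j) b i * w i <= \sum_(0 <= i < j) (b j - q) * w i.
    apply: ler_sum_nat => i /andP[_ ij].
    by rewrite ler_wpM2r ?wge ?lerBrDr ?bm ?ij // (leq_trans (ltnW ij)).
  rewrite big_nat_recr //= -!mulr_sumr -pq; lra.
move: jN; rewrite leq_eqVlt => /predU1P[->|jN].
  by rewrite big_geq // mulr0 aN mul0r.
have : \sum_(j.+1 <= i < N.+1) (b j + q) * w i <= \sum_(j.+1 <= i < N.+1) b i * w i.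
  apply: ler_sum_nat => i /andP[ji iN].
  by rewrite ler_wpM2r ?wge // bm // ji.
rewrite [X in _ <= X -> _]big_add1 /=.
have -> : \sum_(j <= i < N) b i.+1 * w i.+1 = \sum_(j <= i < N.+1) a i * w i.
  rewrite big_nat_recr 1?ltnW //= aN mul0r addr0; apply: eq_big_nat => i /andP[_ iN].
  by rewrite bal.
have -> : \sum_(j <= i < N.+1) a i * w i =
    a j * w j + \sum_(j.+1 <= i < N.+1) a i * w i.
  by rewrite big_ltn // ltnS ltnW.
have : \sum_(j.+1 <= i < N.+1) a i * w i <= \sum_(j.+1 <= i < N.+1) (a j - p) * w i.
  apply: ler_sum_nat => i /andP[ji iN].
  by rewrite ler_wpM2r ?wge // lerBrDr am // ji.
rewrite -!mulr_sumr -pq; lra.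
Qed.

(* The increment of the Stein solution at [j] is a combination of the values
   of [f] with total weight zero whose only positive coefficient, at [j], is
   [x]. *)
Lemma stein_increment_bound (R : realFieldType) (N : nat) (p q : R)
    (a b w f : nat -> R) j :
  0 <= p -> 0 <= q -> p + q = 1 ->
  (forall j, (j <= N)%N -> 0 < w j) -> \sum_(0 <= i < N.+1) w i = 1 ->
  (forall j, (j < N)%N -> a j * w j = b j.+1 * w j.+1) ->
  (forall i j, (i < j <= N)%N -> a j + p <= a i) ->
  (forall i j, (i < j <= N)%N -> b i + q <= b j) ->
  a N = 0 -> b 0%N = 0 -> (forall j, (j < N)%N -> 0 < a j) ->
  (forall j, (0 < j <= N)%N -> 0 < b j) -> (forall i, `|f i| <= 1) ->
  (0 < j <= N)%N ->
  let h i := f i - \sum_(0 <= l < N.+1) w l * f l in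
  exists2 x, [/\ x <= 1, x * a j <= 1 & x * b j <= 1] &
    `|(\sum_(j.+1 <= i < N.+1) w i * h i) / a j
      + (\sum_(0 <= i < j) w i * h i) / b j| <= 2 * x * w j.
Proof.
move=> p0 q0 pq w0 w1 bal am bm aN b0 apos bpos f1 j0N h.
have [] := sum_le_balance _ _ _ _ _ _ _ p0 q0 pq w0 bal am bm aN b0 _ j0N.
have /andP[j0 jN] := j0N.
have bj : 0 < b j by rewrite bpos // j0.
have wj := w0 _ jN.
have split3 (F : nat -> R) : \sum_(0 <= i < N.+1) F i =
    \sum_(0 <= i < j) F i + F j + \sum_(j.+1 <= i < N.+1) F i.
  rewrite (big_cat_nat (n := j)) //=; last by rewrite ltnW.
  by rewrite -addrA; congr (_ + _); rewrite big_ltn.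
have hE m n : \sum_(m <= i < n) w i * h i = \sum_(m <= i < n) w i * f i
    - (\sum_(0 <= l < N.+1) w l * f l) * \sum_(m <= i < n) w i.
  rewrite mulr_sumr -sumrB; apply: eq_bigr => i _; rewrite /h; ring.
have wf m n : (n <= N.+1)%N ->
    `|\sum_(m <= i < n) w i * f i| <= \sum_(m <= i < n) w i.
  move=> nN; apply: le_trans (ler_norm_sum _ _ _) _.
  apply: ler_sum_nat => i /andP[_ iN].
  have wi : 0 < w i by rewrite w0 // -ltnS (leq_trans iN).
  by rewrite normrM (gtr0_norm wi) ler_piMr // ltW.
rewrite !hE.
have := wf 0%N j; have := wf j.+1 N.+1; rewrite leqnn leqW // => /(_ isT) + /(_ isT).
(* At [j = N] the rate [a j] is zero and so is its inverse, by convention; the upper sums are then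
   empty, so the quotient is still correct. *)
have P0 : a j = 0 ->
    \sum_(j.+1 <= i < N.+1) w i = 0 /\
    \sum_(j.+1 <= i < N.+1) w i * f i = 0.
  move=> aj0; have jN' : ~~ (j < N)%N by apply/negP => /apos; rewrite aj0 ltxx.
  by rewrite !big_geq // ltnS leqNgt.
have a0 : 0 <= a j.
  by move: (jN); rewrite leq_eqVlt => /predU1P[->|/apos/ltW]; rewrite ?aN.
have ab1 : a j != 0 -> 1 <= a j + b j.
  have := bm 0%N j; rewrite j0 jN b0 add0r => /(_ isT) qb.
  move: (jN); rewrite leq_eqVlt => /predU1P[->|jN']; first by rewrite aN eqxx.
  have := am j N; rewrite jN' leqnn aN add0r => /(_ isT); lra.
move: w1; rewrite !split3.
have fj := f1 j.
set P := \sum_(j.+1 <= i < N.+1) w i in P0 *.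
set A := \sum_(j.+1 <= i < N.+1) w i * f i in P0 *.
set Q := \sum_(0 <= i < j) w i; set B := \sum_(0 <= i < j) w i * f i.
move=> tot hA hB qa1 pb1.
set ia := (a j)^-1; set ib := (b j)^-1.
have bib : ib * b j = 1 by rewrite mulVf ?gt_eqF.
have ib0 : 0 < ib by rewrite invr_gt0.
have Q0 : 0 <= Q by rewrite (le_trans _ hB).
have P_ge0 : 0 <= P by rewrite (le_trans _ hA).
pose x := Q * ib + P * ia.
have x0 : 0 <= x by rewrite addr_ge0 ?mulr_ge0 ?invr_ge0 // ltW.
have xqE c' : x * c' = c' * Q * ib + c' * P * ia by rewrite /x; ring.
have hq : a j * Q * ib + Q * ib <= Q + w j.
  have -> : a j * Q * ib + Q * ib = (a j + 1) * Q * ib by ring.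
  by rewrite ler_pdivrMr // [_ * b j]mulrC.
have Qib0 : 0 <= Q * ib by rewrite mulr_ge0 // ltW.
have bQ : b j * Q * ib = Q by rewrite mulrAC [b j * _]mulrC bib mul1r.
have [x1 xa1 xb1] : [/\ x <= 1, x * a j <= 1 & x * b j <= 1].
  have [aj|an0] := eqVneq (a j) 0.
    have xE : x = Q * ib by rewrite /x (P0 aj).1 mul0r addr0.
    rewrite aj mulr0 xqE bQ; move: hq tot; rewrite aj (P0 aj).1 xE.
    rewrite !mulr0 !mul0r => hq tot; split; lra.
  have a_gt0 : 0 < a j by rewrite lt_neqAle eq_sym an0.
  have hp : b j * P * ia + P * ia <= P + w j.
    have -> : b j * P * ia + P * ia = (b j + 1) * P * ia by ring.
    by rewrite ler_pdivrMr // [P + _]addrC [_ * a j]mulrC.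
  have aP : a j * P * ia = P by rewrite mulrAC divff // mul1r.
  have Pia0 : 0 <= P * ia by rewrite mulr_ge0 // invr_ge0.
  have ab0 : 0 <= a j + b j - 1 by rewrite subr_ge0 ab1.
  (* [x * a j] and [x * b j] add up to at most [2 - x], and [a j + b j >= 1]; together these force
     [x <= 1]. *)
  have := mulr_ge0 x0 ab0.
  have -> : x * (a j + b j - 1) = a j * Q * ib + P + Q + b j * P * ia - x.
    by rewrite -{1}aP -{2}bQ /x; ring.
  rewrite !xqE aP bQ /x; move: tot Qib0 Pia0 hq hp.
  move: (_ * Q * ib) (_ * P * ia) (Q * ib) (P * ia) => aQ bP Q' P'.
  by clear; split; lra.
exists x; first by split.
have xib : 0 <= ib - x by rewrite subr_ge0 -[ib]mul1r ler_pdivlMr.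
have hA' : `|A * (ia - x)| <= P * (ia - x).
  have [aj|an0] := eqVneq (a j) 0.
    by have [-> ->] := P0 aj; rewrite !mul0r normr0.
  have a_gt0 : 0 < a j by rewrite lt_neqAle eq_sym an0.
  have xia : 0 <= ia - x by rewrite subr_ge0 -[ia]mul1r ler_pdivlMr.
  by rewrite normrM (ger0_norm xia) ler_wpM2r.
have hB' : `|B * (ib - x)| <= Q * (ib - x).
  by rewrite normrM (ger0_norm xib) ler_wpM2r.
have hf : `|w j * f j * x| <= w j * x.
  by rewrite !normrM (gtr0_norm wj) (ger0_norm x0) ler_wpM2r // ler_piMr // ltW.
have -> : (A - (B + w j * f j + A) * P) * ia + (B - (B + w j * f j + A) * Q) * ib
    = A * (ia - x) + B * (ib - x) - w j * f j * x by rewrite /x; ring.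
apply: le_trans (ler_normB _ _) _.
have := ler_normD (A * (ia - x)) (B * (ib - x)).
have -> : 2 * x * w j = P * (ia - x) + Q * (ib - x) + w j * x.
  transitivity (x - (Q + P) * x + w j * x); last by rewrite /x; ring.
  by rewrite (_ : Q + P = 1 - w j); [ring | move: tot; lra].
lra.
Qed.

(** Multiplied by [w j], the equation telescopes by detailed balance: [b j * w j * g j] must be the
    partial sum [H j] of the centred [f]. Centring by the stationary mean [c] makes [H N.+1] vanish,
    so [g] can be zero beyond [N]. *)
Lemma stein_solution (R : realFieldType) (N : nat) (p q : R) (a b f : nat -> R) :
  0 <= p -> 0 <= q -> p + q = 1 ->
  (forall j, (j < N)%N -> 0 < a j) -> (forall j, (0 < j <= N)%N -> 0 < b j) ->
  a N = 0 -> b 0%N = 0 ->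
  (forall i j, (i < j <= N)%N -> a j + p <= a i) ->
  (forall i j, (i < j <= N)%N -> b i + q <= b j) ->
  (forall i, `|f i| <= 1) ->
  exists c (g : nat -> R), [/\ `|c| <= 1, forall j, (N < j)%N -> g j = 0,
    forall j, (j <= N)%N -> f j = c + a j * g j.+1 - b j * g j &
    forall j, (0 < j <= N)%N ->
      exists2 x, [/\ x <= 1, x * a j <= 1 & x * b j <= 1] & `|g j.+1 - g j| <= 2 * x].
Proof.
move=> p0 q0 pq apos bpos aN b0 am bm f1.
have [w [w0 w1 bal]] := detailed_balance _ _ _ _ apos bpos.
pose c := \sum_(0 <= i < N.+1) w i * f i; pose h i := f i - c.
pose H j := \sum_(0 <= i < j) w i * h i.
pose g j := if (j <= N)%N then H j / (b j * w j) else 0.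
have wge i : (i <= N)%N -> 0 <= w i by move=> /w0/ltW.
have HN : H N.+1 = 0.
  rewrite /H; under eq_bigr => i _ do rewrite /h mulrBr [w i * c]mulrC.
  by rewrite sumrB -mulr_sumr w1 mulr1 subrr.
have ag j : (j <= N)%N -> a j * g j.+1 = H j.+1 / w j.
  rewrite leq_eqVlt => /predU1P[->|jN]; first by rewrite HN aN !mul0r.
  rewrite /g jN -bal // -[H _ / _ in LHS]mulrC mulrA.
  by field; rewrite !gt_eqF ?apos ?w0 // ltnW.
have bg j : (j <= N)%N -> b j * g j = H j / w j.
  case: j => [|j] jN; first by rewrite b0 /H big_geq // !mul0r.
  rewrite /g jN; field; rewrite !gt_eqF ?w0 //; exact: bpos.
exists c, g; split.
- apply: le_trans (ler_norm_sum _ _ _) _; rewrite -w1.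
  apply: ler_sum_nat => i /andP[_ iN]; rewrite ltnS in iN.
  by rewrite normrM (ger0_norm (wge _ iN)) ler_piMr ?wge.
- by move=> j Nj; rewrite /g leqNgt Nj.
- move=> j jN; rewrite -addrA ag // bg // -mulrBl /H big_nat_recr //=.
  by rewrite addrAC subrr add0r mulrAC divff ?gt_eqF ?w0 // mul1r /h addrC subrK.
move=> j jN; have [j0 jN'] := andP jN; have wj := w0 _ jN'.
have [x hx hE] :=
  stein_increment_bound _ _ _ _ _ _ _ _ _ p0 q0 pq w0 w1 bal am bm aN b0
    apos bpos f1 jN.
exists x => //; move: hE; rewrite -/c -/h -/(H j).
set T := \sum_(j.+1 <= i < N.+1) _ => hE.
have HT : H j.+1 = - T.
  apply/eqP; rewrite -addr_eq0 -HN /H /T.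
  by rewrite [X in _ == X](big_cat_nat (n := j.+1)) //= ltnS.
have gS : g j.+1 = - (T / a j / w j).
  rewrite /g; case: ltnP => [jN2|Nj].
    rewrite -bal // HT; field; rewrite !gt_eqF //; exact: apos.
  by rewrite /T big_geq // !mul0r oppr0.
have gj : g j = H j / b j / w j.
  by rewrite /g jN' invfM mulrA.
rewrite -(ler_pM2r wj) -{1}(gtr0_norm wj) -normrM gS gj mulrBl mulNr !divfK ?gt_eqF //.
by rewrite -opprD normrN.
Qed.

(* The rates [p (T - j)] and [(1 - p) j] are those of a binomial law; where
   one of them is small the other is large, since
   [(1 - p) p (T - j) + p (1 - p) j = p (1 - p) T]. *)
Lemma pseudo_binomial_stein (R : realFieldType) (N : nat) (p t : R) (f : nat -> R) :
  0 < p < 1 -> (0 < N)%N -> N%:R <= t -> (forall i, `|f i| <= 1) ->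
  exists c (g : nat -> R), [/\ `|c| <= 1, forall j, (N < j)%N -> g j = 0,
    forall j, (j <= N)%N ->
      f j = c + p * (t - j%:R) * g j.+1 - (1 - p) * j%:R * g j &
    forall j, `|g j.+2 - g j.+1| <= 2 /\
      `|g j.+2 - g j.+1| <= 2 / (p * (1 - p) * N%:R)].
Proof.
move=> /andP[p0 p1] N0 Nt f1; have q0 : 0 < 1 - p by rewrite subr_gt0.
(* [t] need not be an integer, so the birth rate is cut to zero at [N]; the equation is unchanged
   there because [g N.+1 = 0]. *)
pose a j := if (j < N)%N then p * (t - j%:R) else 0.
pose b j := (1 - p) * j%:R : R.
have apos j : (j < N)%N -> 0 < a j.
  by move=> jN; rewrite /a jN mulr_gt0 // subr_gt0 (lt_le_trans _ Nt) ?ltr_nat.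
have bpos j : (0 < j <= N)%N -> 0 < b j.
  by move=> /andP[j0 _]; rewrite mulr_gt0 ?ltr0n.
have aN : a N = 0 by rewrite /a ltnn.
have b0 : b 0%N = 0 by rewrite /b mulr0.
have am i j : (i < j <= N)%N -> a j + p <= a i.
  move=> /andP[ij jN]; rewrite /a (leq_trans ij jN).
  have h1 : (i%:R + 1 <= j%:R :> R) by rewrite natr1 ler_nat.
  case: ltnP => [_|_]; first by have := ler_wpM2l (ltW p0) h1; lra.
  have h2 : j%:R <= N%:R :> R by rewrite ler_nat.
  rewrite add0r -{1}[p]mulr1 ler_pM2l //; lra.
have bm i j : (i < j <= N)%N -> b i + (1 - p) <= b j.
  move=> /andP[ij jN]; rewrite /b -{2}[1 - p]mulr1 -mulrDr ler_pM2l //.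
  by rewrite natr1 ler_nat.
have pq1 : p + (1 - p) = 1 by rewrite addrC subrK.
have [c [g [c1 gN gE gd]]] :=
  stein_solution _ _ _ _ _ _ _ (ltW p0) (ltW q0) pq1 apos bpos aN b0 am bm f1.
exists c, g; split => // [j jN|j].
  rewrite (gE j jN) /a; case: ltnP => // Nj.
  by rewrite gN // !mulr0.
have [jN|jN] := leqP j.+1 N; last first.
  by rewrite !gN ?ltnS ?(ltnW jN) // subr0 normr0 divr_ge0 // !mulr_ge0 // ltW.
have [x [x1 xa xb] hx] := gd j.+1 (jN : 0 < j.+1 <= N)%N.
split; apply: le_trans hx _; first by move: x1; lra.
rewrite ler_wpM2l //.
have D0 : 0 < p * (1 - p) * N%:R by rewrite !mulr_gt0 ?ltr0n.
rewrite -[_^-1]mul1r ler_pdivlMr //.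
have [x0|/ltW x0] := lerP x 0.
  by rewrite (le_trans _ ler01) // mulr_le0_ge0 // ltW.
have h2 := ler_wpM2l (ltW p0) xb; rewrite mulr1 in h2.
move: xa; rewrite /a; case: ltnP => [_ h1|Nj _]; last first.
  (* At the end point the birth rate was cut, and the death rate alone gives the bound. *)
  have jE : j.+1 = N by apply/eqP; rewrite eqn_leq jN Nj.
  by move: h2; rewrite /b jE; lra.
have := ler_wpM2l (ltW q0) h1; rewrite mulr1 => h3.
apply: le_trans (_ : x * (p * (1 - p) * t) <= 1).
  by rewrite ler_wpM2l // ler_wpM2l ?mulr_ge0 // ltW.
move: h2; rewrite /b; lra.
Qed.

(** * Perturbation *)

Definition stein_op {R : realFieldType} (p m al : R) (g : nat -> R) (k : nat) : R :=
  (m * p + al - p * k%:R) * g k.+1 - (1 - p) * k%:R * g k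
  + al * p * (g k.+2 - g k.+1).

(** With [k = i + j], the operator splits into the binomial one in [j], [1 - p] times the Poisson
    one in [i], and [p] times the latter for the shifted [g]. The recursions for [u] and [v] make
    each sum to zero; boundary terms vanish as [g] does beyond [N]. *)
Lemma convolution_stein (R : realFieldType) (N : nat) (p m al : R) (u v g : nat -> R) :
  (forall i, i.+1%:R * u i.+1 = al * u i) ->
  (forall j, (1 - p) * j.+1%:R * v j.+1 = p * (m - j%:R) * v j) ->
  (forall k, (N < k)%N -> g k = 0) ->
  \sum_(i < N.+1) \sum_(j < N.+1) u i * v j * stein_op p m al g (i + j) = 0.
Proof.
move=> hu hv gN.
have Pois f : f N.+1 = 0 ->
    \sum_(i < N.+1) u i * (i%:R * f i) = al * \sum_(i < N.+1) u i * f i.+1.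
  move=> fN; rewrite big_ord_recl mul0r mulr0 add0r big_ord_recr /= fN mulr0 addr0.
  rewrite mulr_sumr; apply: eq_bigr => i _ /=.
  by rewrite /bump add1n [RHS]mulrA -hu; ring.
have Bin f : f N.+1 = 0 ->
    \sum_(j < N.+1) v j * (p * (m - j%:R) * f j.+1) =
    \sum_(j < N.+1) v j * ((1 - p) * j%:R * f j).
  move=> fN; rewrite big_ord_recr /= fN !mulr0 addr0.
  rewrite [RHS]big_ord_recl !(mul0r, mulr0) add0r; apply: eq_bigr => j _ /=.
  rewrite /bump add1n; have := hv j; move: (v j.+1) => y hy.
  by rewrite mulrA [v j * _]mulrC -hy; ring.
have gN' k : (N < k + N.+1)%N by rewrite addnS ltnS leq_addl.
have gN1 k : g (k + N.+1)%N = 0 by rewrite gN.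
have gN2 k : g (k + N.+1).+1 = 0 by rewrite gN // ltnS ltnW.
transitivity (\sum_(i < N.+1) u i * \sum_(j < N.+1)
   v j * (p * (m - j%:R) * g (i + j.+1)%N - (1 - p) * j%:R * g (i + j)%N)
 + \sum_(j < N.+1) v j * (1 - p) *
   (al * (\sum_(i < N.+1) u i * g (i.+1 + j)%N)
    - \sum_(i < N.+1) u i * (i%:R * g (i + j)%N))
 + \sum_(j < N.+1) v j * p *
   (al * (\sum_(i < N.+1) u i * g (i.+1 + j).+1)
    - \sum_(i < N.+1) u i * (i%:R * g (i + j).+1))).
  have e (w : 'I_N.+1 -> R) (F H : 'I_N.+1 -> 'I_N.+1 -> R) :
    \sum_(j < N.+1) w j * (al * (\sum_(i < N.+1) F i j) - \sum_(i < N.+1) H i j) =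
    \sum_(i < N.+1) \sum_(j < N.+1) w j * (al * F i j - H i j).
    rewrite exchange_big; apply: eq_bigr => j _ /=.
    by rewrite -mulr_sumr sumrB -mulr_sumr.
  rewrite (e (fun j => v j * (1 - p)) (fun i j => u i * g (i.+1 + j)%N)).
  rewrite (e (fun j => v j * p) (fun i j => u i * g (i.+1 + j).+1)).
  rewrite -!big_split /=; apply: eq_bigr => i _; rewrite mulr_sumr -!big_split /=.
  apply: eq_bigr => j _; rewrite /stein_op natrD addnS addSn; ring.
rewrite big1 ?add0r => [|i _]; last first.
  under eq_bigr => j _ do rewrite mulrBr.
  by rewrite sumrB (Bin (fun j => g (i + j)%N)) ?gN1 // subrr mulr0.
rewrite !big1 ?addr0 // => j _.
  by rewrite (Pois (fun i => g (i + j).+1)) ?subrr ?mulr0 // addnC gN2.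
by rewrite (Pois (fun i => g (i + j)%N)) ?subrr ?mulr0 // addnC gN1.
Qed.

(* Testing [w - y] against its own sign [f] and solving the Stein equation of
   the pseudo-binomial law for [f] bounds the distance by the Stein
   discrepancy of [w], plus the Poisson perturbation term, which is at most
   [2 * theta] times the distance itself. *)
Lemma stein_bootstrap (R : realFieldType) (N : nat) (p m al tw ty B : R)
    (w y : nat -> R) :
  0 < p < 1 -> (0 < N)%N -> N%:R <= m + al / p -> 0 <= al ->
  0 <= tw -> 0 <= ty ->
  \sum_(k < N.+1) w k = 1 - tw -> \sum_(k < N.+1) y k = 1 - ty ->
  (forall g, (forall k, (N < k)%N -> g k = 0) ->
    \sum_(k < N.+1) y k * stein_op p m al g k = 0) ->
  (forall g, (forall k, (N < k)%N -> g k = 0) ->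
    (forall k, `|g k.+2 - g k.+1| <= 2) ->
    (forall k, `|g k.+2 - g k.+1| <= 2 / (p * (1 - p) * N%:R)) ->
    `|\sum_(k < N.+1) w k * stein_op p m al g k| <= B) ->
  (1 - 2 * (al / ((1 - p) * N%:R))) * \sum_(k < N.+1) `|w k - y k|
    <= B + tw + ty.
Proof.
move=> /andP[p0 p1] N0 NT al0 tw0 ty0 sw sy steinY steinW.
have q0 : 0 < 1 - p by rewrite subr_gt0.
have N0' : 0 < N%:R :> R by rewrite ltr0n.
pose f k := Num.sg (w k - y k).
have f1 k : `|f k| <= 1 by rewrite /f normr_sg lern1 leq_b1.
have p01 : 0 < p < 1 by rewrite p0.
have [c [g [c1 gN gE gd]]] := pseudo_binomial_stein _ _ _ _ _ p01 N0 NT f1.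
have gd1 k : `|g k.+2 - g k.+1| <= 2 by case: (gd k).
have gd2 k : `|g k.+2 - g k.+1| <= 2 / (p * (1 - p) * N%:R) by case: (gd k).
set D := \sum_(k < N.+1) _.
(* Difference of the means of [f] under [w] and [y]: the constant [c] sees only the missing masses,
   [y] is annihilated, and the last term removes the Poisson perturbation contained in
   [stein_op]. *)
have DE : D = c * (ty - tw) + \sum_(k < N.+1) w k * stein_op p m al g k
    - al * p * \sum_(k < N.+1) (w k - y k) * (g k.+2 - g k.+1).
  have -> : ty - tw = \sum_(k < N.+1) w k - \sum_(k < N.+1) y k.
    by rewrite sw sy; ring.
  rewrite [X in _ + X - _](_ : _ = \sum_(k < N.+1) w k * stein_op p m al g k
    - \sum_(k < N.+1) y k * stein_op p m al g k); last by rewrite (steinY g gN) subr0.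
  rewrite -!sumrB !mulr_sumr.
  rewrite -big_split -sumrB; apply: eq_bigr => k _ /=.
  rewrite normrEsg -/(f k) (gE k) -1?ltnS // /stein_op.
  by field; rewrite gt_eqF.
have hD : `|\sum_(k < N.+1) (w k - y k) * (g k.+2 - g k.+1)|
    <= 2 / (p * (1 - p) * N%:R) * D.
  apply: le_trans (ler_norm_sum _ _ _) _; rewrite mulrC mulr_suml.
  by apply: ler_sum => k _; rewrite normrM ler_wpM2l.
have hc : `|c * (ty - tw)| <= tw + ty.
  rewrite normrM; apply: le_trans (ler_piMl (normr_ge0 _) c1) _.
  by apply: le_trans (ler_normB _ _) _; rewrite !ger0_norm // addrC.
have hB := steinW g gN gd1 gd2.
have hDE : D <= (tw + ty) + B + al * p * (2 / (p * (1 - p) * N%:R) * D).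
  rewrite {1}DE; apply: lerD; last first.
    rewrite -mulrN ler_wpM2l ?mulr_ge0 ?(ltW p0) //.
    by rewrite (le_trans _ hD) // -normrN ler_norm.
  by apply: lerD; rewrite (le_trans (ler_norm _)).
have -> : (1 - 2 * (al / ((1 - p) * N%:R))) * D =
    D - al * p * (2 / (p * (1 - p) * N%:R) * D).
  by field; rewrite !gt_eqF.
lra.
Qed.

(** * Integer-valued random variables *)

Lemma measure_bigsetU_fin (R : realType) (d : measure_display)
    (T : measurableType d) (mu : {measure set T -> \bar R})
    (I : finType) (D : pred I) (F : I -> set T) :
  (forall i, D i -> measurable (F i)) ->
  (forall i j t, D i -> D j -> F i t -> F j t -> i = j) ->
  mu (\big[setU/set0]_(i | D i) F i) = (\sum_(i | D i) mu (F i))%E.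
Proof.
move=> mF dF; rewrite -!(big_filter _ D) -bigcup_seq measure_fin_bigcup //.
- by rewrite -fsbig_seq // filter_uniq // index_enum_uniq.
- move=> i j /=; rewrite !mem_filter => /andP[Di _] /andP[Dj _] [t [Fi Fj]].
  exact: dF Fi Fj.
- by move=> i /=; rewrite mem_filter => /andP[/mF].
Qed.

Section IntegerVariable.
Variables (R : realType) (d : measure_display) (T : measurableType d).
Variables (P : probability T R) (X : T -> int).
Hypothesis mX : forall B : set int, measurable (X @^-1` B).
Hypothesis X_ge0 : forall t, 0 <= X t.

Definition point_mass (k : nat) : R := fine (P (X @^-1` [set k%:Z])).

Lemma point_massE k : P (X @^-1` [set k%:Z]) = (point_mass k)%:E.
Proof. by rewrite /point_mass fineK // fin_num_measure. Qed.

Lemma tailE N : P [set t | (X t > N%:Z)%R] = (1 - \sum_(k < N.+1) point_mass k)%:E.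
Proof.
have -> : [set t | (X t > N%:Z)%R] =
    ~` \big[setU/set0]_(k < N.+1) (X @^-1` [set (k : nat)%:Z]).
  apply/seteqP; split => t /=;
    rewrite -(bigcup_mkord N.+1 (fun k => X @^-1` [set k%:Z])).
    by move=> NX [k /= kN Xk]; move: NX; rewrite Xk ltz_nat ltnNge -ltnS kN.
  move=> nX; rewrite ltNge; apply/negP => XN; apply: nX.
  exists `|X t|%N => /=; last by rewrite gez0_abs.
  by rewrite ltnS -lez_nat gez0_abs.
rewrite probability_setC; last by apply: bigsetU_measurable => k _.
rewrite measure_bigsetU_fin //; last first.
  by move=> i j t _ _ /= -> [] /val_inj.
rewrite (eq_bigr (fun k : 'I_N.+1 => (point_mass k)%:E)) => [|k _]; last first.
  exact: point_massE.
by rewrite sumEFin -EFinB.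
Qed.

Lemma tail_ge0 N : 0 <= 1 - \sum_(k < N.+1) point_mass k.
Proof. by rewrite -lee_fin -tailE. Qed.

Lemma sum_mass_le_tail N (r : seq int) : uniq r ->
  (forall k, k \in r -> ~~ (0 <= k <= N%:Z)) ->
  (\sum_(k <- r) P (X @^-1` [set k]) <= P [set t | (X t > N%:Z)%R])%E.
Proof.
move=> ur hr.
rewrite fsbig_seq // -measure_fin_bigcup //; last first.
  by move=> i j _ _ [t [/= <- <-]].
apply: le_measure; rewrite ?inE.
- by apply: fin_bigcup_measurable => // k _; exact: mX.
- exact: (mX [set k | k > N%:Z]).
move=> t [k /= kr Xk]; have := hr _ kr.
by rewrite -Xk X_ge0 /= -ltNge.
Qed.

End IntegerVariable.

Arguments point_mass {R d T}.
Arguments point_massE {R d T P X}.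
Arguments tailE {R d T P X}.
Arguments tail_ge0 {R d T P X}.
Arguments sum_mass_le_tail {R d T P X}.

(** In any finite set of integers, the points of [[0, N]] contribute at most the first sum. At the
    others the difference is at most the sum of the two masses, and these lie in the upper tails
    since [X] and [Y] are nonnegative. *)
Lemma tv_norm_le (R : realType) (d d' : measure_display)
    (T : measurableType d) (T' : measurableType d')
    (P : probability T R) (Q : probability T' R) (X : T -> int) (Y : T' -> int)
    (N : nat) :
  (forall B, measurable (X @^-1` B)) -> (forall B, measurable (Y @^-1` B)) ->
  (forall t, 0 <= X t) -> (forall t, 0 <= Y t) ->
  (tv_norm (pushforward P X \- pushforward Q Y) <=
   (\sum_(k < N.+1) `|point_mass P X k - point_mass Q Y k|)%:E +
   P [set t | (X t > N%:Z)%R] + Q [set t | (Y t > N%:Z)%R])%E.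
Proof.
move=> mX mY X0 Y0; apply: ge_ereal_sup => /= _ [F [finF _] <-].
rewrite fsbig_finite //=; have := finmap.fset_uniq (fset_set F).
move: (finmap.enum_fset _) => r ur.
rewrite (bigID (fun k : int => 0 <= k <= N%:Z)) /= -addeA.
apply: leeD.
  rewrite -big_filter; set s := [seq _ <- _ | _].
  have us : uniq s by rewrite filter_uniq.
  have hs k : k \in s -> exists2 j : 'I_N.+1, k = (j : nat)%:Z & true.
    rewrite mem_filter => /andP[/andP[k0 kN] _].
    have kN' : (`|k|%N < N.+1)%N by rewrite ltnS -lez_nat gez0_abs.
    by exists (Ordinal kN') => //=; rewrite gez0_abs.
  pose e := [seq (nat_of_ord i)%:Z | i <- enum 'I_N.+1].
  have ue : uniq e by rewrite map_inj_uniq ?enum_uniq // => i j [] /val_inj.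
  apply: (@le_trans _ _
      (\sum_(k <- e) `|(pushforward P X \- pushforward Q Y) [set k]|)%E).
    have se : perm_eq e (s ++ [seq k <- e | k \notin s]).
      apply: uniq_perm => //.
        rewrite cat_uniq us filter_uniq // andbT.
        by apply/hasPn => k; rewrite mem_filter => /andP[].
      move=> k; rewrite mem_cat mem_filter; case: (boolP (k \in s)) => //= ks.
      by have [j ->] := hs _ ks; rewrite map_f // mem_enum.
    by rewrite [leRHS](perm_big _ se) big_cat /= leeDl // sume_ge0.
  rewrite big_map big_enum /= -sumEFin; apply: lee_sum => k _.
  by rewrite /pushforward !point_massE // -EFinB.
rewrite -big_filter; set s := [seq _ <- _ | _].
apply: (@le_trans _ _ (\sum_(k <- s) (P (X @^-1` [set k]) + Q (Y @^-1` [set k])))%E).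
  apply: lee_sum => k _; apply: le_trans (lee_abs_sub _ _) _.
  by rewrite /pushforward !gee0_abs.
rewrite big_split /=; apply: leeD; apply: sum_mass_le_tail => //.
- by rewrite filter_uniq.
- by move=> k; rewrite mem_filter => /andP[].
- by rewrite filter_uniq.
- by move=> k; rewrite mem_filter => /andP[].
Qed.

(** * Law of the indicator sum and its Stein functional *)

Lemma prod_bern_expand (R : comNzRingType) (I : finType) (ps : I -> R) :
  \prod_i bern (ps i) = \sum_(A : {set I})
    (\prod_i (if i \in A then ps i else 1 - ps i))%:P * 'X^#|A|.
Proof.
have -> : \prod_i bern (ps i) = \prod_i ((ps i)%:P * 'X + (1 - ps i)%:P).
  by apply: eq_bigr => i _; rewrite /bern polyCB polyC1; ring.
rewrite bigA_distr; apply: eq_bigr => A _.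
rewrite -prodr_const [X in _ * X]big_mkcond rmorph_prod -big_split /=.
by apply: eq_bigr => i _; case: ifP; rewrite ?mulr1.
Qed.

Lemma coef_prod_bern (R : comNzRingType) (I : finType) (ps : I -> R) k :
  (\prod_i bern (ps i))`_k = \sum_(A : {set I} | #|A| == k)
    \prod_i (if i \in A then ps i else 1 - ps i).
Proof.
rewrite prod_bern_expand coef_sum [RHS]big_mkcond /=.
by apply: eq_bigr => A _; rewrite coefCM coefXn eq_sym mulr_natr mulrb.
Qed.

Lemma stein_op_eq0 (R : realFieldType) (N : nat) (p m al : R) (g : nat -> R) :
  (forall k, (N < k)%N -> g k = 0) ->
  forall k, (N < k)%N -> stein_op p m al g k = 0.
Proof.
move=> gN k Nk; rewrite /stein_op !gN; try lia.
by rewrite subrr !mulr0 subr0 addr0.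
Qed.

(** Multiplying the derivative of [G] by ['X] weights each coefficient by [k]; a further factor
    [bern p] yields both [(1 - p) k g(k)] and [p k g(k + 1)]. *)
Lemma sum_coef_stein_op (R : realFieldType) (G : {poly R}) (N : nat)
    (p m al : R) (g : nat -> R) : (forall k, (N < k)%N -> g k = 0) ->
  \sum_(k < N.+1) G`_k * stein_op p m al g k =
  act ('X * ((m * p + al)%:P * G - (1 + p%:P * ('X - 1)) * G^`()
    + (al * p)%:P * ('X - 1) * G)) g 0.
Proof.
move=> gN.
transitivity (act G (stein_op p m al g) 0).
  rewrite (act_wide _ _ _ _ _ (leq_addr N.+1 (size G))) /=.
  rewrite (big_ord_widen (size G + N.+1) (fun k => G`_k * stein_op p m al g k))
    ?leq_addl //.
  rewrite big_mkcond /=; apply: eq_bigr => k _.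
  by case: ltnP => // Nk; rewrite add0n (stein_op_eq0 _ _ _ _ _ _ gN) ?mulr0.
rewrite (_ : 'X * _ = (m * p + al)%:P * ('X * G) - ('X * G^`()) * bern p
    + (al * p)%:P * ('X * ('X * G) - 'X * G)); last by rewrite /bern; ring.
have actE f x : act G f x = \sum_(k < size G) G`_k * f (x + k)%N by [].
rewrite actD actB !actCM actB !actXM actM act_deriv !actE !mulr_sumr.
rewrite -!sumrB mulr_sumr -big_split; apply: eq_bigr => k _ /=.
rewrite act_bern /stein_op add0n !add1n add2n; ring.
Qed.

Section IndicatorSum.
Variables (R : realType) (d : measure_display) (T : measurableType d).
Variables (P : probability T R) (n : nat) (ps : 'I_n -> R).
Variable Ind : 'I_n -> {RV P >-> bool}.
Hypothesis hI : forall i, P [set t | Ind i t = true] = (ps i)%:E.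
Hypothesis hindep : mutually_independent Ind.

(** The event that the set of successes is exactly [A], phrased to match [mutually_independent]. *)
Let atom (A : {set 'I_n}) :=
  [set t | forall i, i \in [set: 'I_n]%SET -> Ind i t = (i \in A)].

Let mInd i b : measurable (Ind i @^-1` [set b]).
Proof. exact: measurable_funPTI. Qed.

Let ps01 i : 0 <= ps i <= 1.
Proof.
by rewrite -!lee_fin -hI measure_ge0 probability_le1 //; exact: (mInd i true).
Qed.

Let atom_prob A : P (atom A) = (\prod_i (if i \in A then ps i else 1 - ps i))%:E.
Proof.
rewrite /atom (hindep [set: 'I_n]%SET (fun i => [set i \in A])) //.
rewrite -prodEFin big_mkcond /=; apply: eq_bigr => i _; rewrite finset.in_setT.
case: ifP => _; first exact: hI.
rewrite (_ : _ @^-1` _ = ~` [set t | Ind i t = true]); last first.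
  by apply/seteqP; split => t /=; case: (Ind i t).
by rewrite probability_setC ?hI //; exact: (mInd i true).
Qed.

Let matom A : measurable (atom A).
Proof.
rewrite (_ : atom A = \bigcap_(i in [set: 'I_n]) (Ind i @^-1` [set i \in A])).
  by apply: fin_bigcap_measurable.
apply/seteqP; split => t /= h i; first by move=> _; apply: h; rewrite finset.in_setT.
by move=> _; apply: h.
Qed.

Let W := indicator_sum Ind.

Let W_atom A t : atom A t -> W t = #|A|%:Z.
Proof.
move=> h; rewrite /W /indicator_sum.
rewrite (eq_bigr (fun i => if i \in A then 1 else 0)); last first.
  by move=> i _; rewrite h ?finset.in_setT //; case: ifP.
by rewrite -big_mkcond sumr_const /= natz.
Qed.

Let WE B : W @^-1` B = \big[setU/set0]_(A : {set 'I_n} | `[< B #|A|%:Z >]) atom A.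
Proof.
rewrite -bigcup_seq_cond; apply/seteqP.
split => [t Bt|t [A /= /andP[_ /asboolP BA] At]].
  have hA : atom [set i | Ind i t] t by move=> i _; rewrite inE.
  exists [set i | Ind i t]%SET => //=.
  by rewrite mem_index_enum; apply/asboolP; rewrite -(W_atom _ _ hA).
by rewrite /= (W_atom _ _ At).
Qed.

Lemma indicator_sum_ge0 t : 0 <= W t.
Proof. by rewrite sumr_ge0. Qed.

Lemma measurable_indicator_sum B : measurable (W @^-1` B).
Proof. by rewrite WE; apply: bigsetU_measurable => A _; exact: matom. Qed.

Lemma indicator_sum_mass k : point_mass P W k = (\prod_i bern (ps i))`_k.
Proof.
rewrite /point_mass WE measure_bigsetU_fin; last 2 first.
- by move=> A _; exact: matom.
- move=> A B t _ _ hA hB; apply/setP => i.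
  by rewrite -hA ?hB ?finset.in_setT.
rewrite (eq_bigr _ (fun A _ => atom_prob A)) sumEFin /= coef_prod_bern.
by apply: eq_bigl => A; apply/asboolP/eqP => [[]|->].
Qed.

Lemma indicator_means01 i : 0 <= ps i <= 1.
Proof. exact: ps01. Qed.

End IndicatorSum.

(** * Poisson and binomial convolution *)

(** Follows the case split of [poisson_prob], so that mean 0 gives the point mass at 0. *)
Definition poisson_mass {R : realType} (al : R) (i : nat) : R :=
  if 0 < al then poisson_pmf al i else (i == 0%N)%:R.

Lemma poisson_prob_set1 (R : realType) (al : R) k i :
  poisson_prob al k [set i] = (poisson_mass al i)%:E.
Proof.
rewrite /poisson_prob /poisson_mass; case: ifP => _.
  by rewrite esum_set1 // lee_fin poisson_pmf_ge0.
rewrite diracE; congr (_%:R)%:E; case: eqP => [->|i0]; first by rewrite mem_set.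
by rewrite memNset // => /esym.
Qed.

Lemma poisson_mass_rec (R : realType) (al : R) i : 0 <= al ->
  i.+1%:R * poisson_mass al i.+1 = al * poisson_mass al i.
Proof.
rewrite /poisson_mass le_eqVlt => /predU1P[<-|al0].
  by rewrite ltxx mulr0 mul0r.
rewrite al0 /poisson_pmf al0 exprS factS natrM.
by field; rewrite pnatr_eq0 -lt0n fact_gt0 nat1r pnatr_eq0.
Qed.

Lemma binomial_prob_set1 (R : realType) (m : nat) (p : R) i : 0 <= p <= 1 ->
  binomial_prob m p [set i] = (binomial_pmf m p i)%:E.
Proof.
move=> p01; rewrite /binomial_prob p01 esum_set1 // lee_fin.
exact: binomial_pmf_ge0.
Qed.

Lemma binomial_pmf_rec (R : realType) (m : nat) (p : R) j :
  (1 - p) * j.+1%:R * binomial_pmf m p j.+1 =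
  p * (m%:R - j%:R) * binomial_pmf m p j.
Proof.
have [jm|mj] := ltnP j m; last first.
  rewrite /binomial_pmf bin_small // mulr0n mulr0.
  move: mj; rewrite leq_eqVlt => /predU1P[->|mj].
    by rewrite subrr mulr0 mul0r.
  by rewrite bin_small // mulr0n mulr0.
have hbin : j.+1%:R * 'C(m, j.+1)%:R = (m%:R - j%:R) * 'C(m, j)%:R :> R.
  by rewrite -natrB 1?ltnW // -!natrM mul_bin_left.
rewrite /binomial_pmf /unstable.onem -(subnSK jm) !exprS 
  -[_ *+ 'C(m, j.+1)]mulr_natr -[_ *+ 'C(m, j)]mulr_natr.
move: hbin; move: ('C(_, _)%:R) ('C(_, j)%:R) (_ ^+ j) (_ ^+ (m - _)) => c1 c2 x y.
move: (j.+1%:R) (m%:R - j%:R) => k1 k2 hbin.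
transitivity (p * (1 - p) * x * y * (k1 * c1)); first by ring.
by rewrite hbin; ring.
Qed.

Section Convolution.
Variables (R : realType) (d : measure_display) (T : measurableType d).
Variables (Q : probability T R) (Y1 Y2 : {RV Q >-> nat}) (u v : nat -> R).
Hypothesis hu : forall i, Q (Y1 @^-1` [set i]) = (u i)%:E.
Hypothesis hv : forall j, Q (Y2 @^-1` [set j]) = (v j)%:E.
Hypothesis hY : independent2 Y1 Y2.

Let mY (Y : {RV Q >-> nat}) (B : set nat) : measurable (Y @^-1` B).
Proof. exact: measurable_funPTI. Qed.

Lemma sum2_ge0 t : 0 <= sum2 Y1 Y2 t.
Proof. by rewrite addr_ge0. Qed.

Lemma measurable_sum2 B : measurable (sum2 Y1 Y2 @^-1` B).
Proof.
rewrite (_ : _ @^-1` B = \bigcup_i (Y1 @^-1` [set i] `&`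
    Y2 @^-1` [set j | B (i%:Z + j%:Z)])).
  by apply: bigcupT_measurable => i; apply: measurableI; apply: mY.
by apply/seteqP; split => [t Bt|t [i _ [/= <-]]] //; exists (Y1 t).
Qed.

Lemma sum2_mass N k : (k <= N)%N ->
  point_mass Q (sum2 Y1 Y2) k =
  \sum_(i < N.+1) \sum_(j < N.+1 | (i + j)%N == k) u i * v j.
Proof.
move=> kN; pose F (ij : 'I_N.+1 * 'I_N.+1) :=
  Y1 @^-1` [set (ij.1 : nat)] `&` Y2 @^-1` [set (ij.2 : nat)].
rewrite /point_mass (_ : _ @^-1` _ =
    \big[setU/set0]_(ij : 'I_N.+1 * 'I_N.+1 | (ij.1 + ij.2 == k)%N) F ij); last first.
  rewrite -bigcup_seq_cond; apply/seteqP.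
  split => [t /=|t [[i j] /= /andP[_ /eqP ijk] [/= h1 h2]]].
    rewrite /sum2 -PoszD => -[Yk].
    have h1 : (Y1 t < N.+1)%N by lia.
    have h2 : (Y2 t < N.+1)%N by lia.
    by exists (Ordinal h1, Ordinal h2) => //=; rewrite mem_index_enum Yk eqxx.
  by rewrite /= /sum2 h1 h2 -PoszD ijk.
rewrite measure_bigsetU_fin; last 2 first.
- by move=> ij _; apply: measurableI; apply: mY.
- move=> [i j] [i' j'] t _ _ [/= h1 h2] [/= h3 h4].
  by congr pair; apply: val_inj; rewrite /= -?h1 -?h2.
rewrite (eq_bigr (fun ij : 'I_N.+1 * 'I_N.+1 => (u ij.1 * v ij.2)%:E)); last first.
  by move=> [i j] _; rewrite EFinM -hu -hv; exact: hY.
by rewrite sumEFin /= pair_big_dep.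
Qed.

(** Restricting to a square is exact: pairs with [i + j > N] contribute nothing because [f] vanishes
    there. *)
Lemma sum_sum2_mass N (f : nat -> R) : (forall k, (N < k)%N -> f k = 0) ->
  \sum_(k < N.+1) point_mass Q (sum2 Y1 Y2) k * f k =
  \sum_(i < N.+1) \sum_(j < N.+1) u i * v j * f (i + j)%N.
Proof.
move=> fN.
under eq_bigr => k _ do rewrite (@sum2_mass N) -1?ltnS // mulr_suml.
rewrite exchange_big; apply: eq_bigr => i _ /=.
under eq_bigr => k _ do rewrite mulr_suml big_mkcond /=.
rewrite exchange_big; apply: eq_bigr => j _ /=.
have [ijN|Nij] := ltnP (i + j) N.+1; last first.
  rewrite fN // mulr0 big1 // => k _; case: eqP => // ijk.
  by have := ltn_ord k; lia.
rewrite (bigD1 (Ordinal ijN)) //= eqxx big1 ?addr0 // => k.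
by rewrite -val_eqE /= eq_sym => /negPf ->.
Qed.

End Convolution.

(** * Relations between the matched parameters *)

Section MatchedMoments.
Variables (R : realType) (n : nat) (ps : 'I_n -> R).
Hypothesis ps01 : forall i, 0 <= ps i <= 1.
Hypothesis hp : 0 < bcp_p ps < 1.

Let S := power_sum ps.
Let p := bcp_p ps.
Let M : R := (bcp_M ps)%:R.
Let ps0 i : 0 <= ps i. Proof. by case/andP: (ps01 i). Qed.
Let S0 k : 0 <= S k. Proof. by rewrite sumr_ge0 // => i _; rewrite exprn_ge0. Qed.

Lemma power_sum2_gt0 : 0 < power_sum ps 2.
Proof.
rewrite lt_neqAle (S0 2) andbT; apply/eqP => S20.
by move: hp; rewrite /bcp_p -S20 invr0 mulr0 ltxx.
Qed.

Lemma power_sum3E : p * S 2 = S 3.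
Proof. by rewrite /p /bcp_p divfK // gt_eqF // power_sum2_gt0. Qed.

Let S3_gt0 : 0 < S 3.
Proof. by rewrite -power_sum3E mulr_gt0 ?power_sum2_gt0 //; case/andP: hp. Qed.

Let S20 : S 2 != 0. Proof. by rewrite gt_eqF // power_sum2_gt0. Qed.
Let S30 : S 3 != 0. Proof. by rewrite gt_eqF. Qed.

Lemma bcp_delta_ge0 : 0 <= bcp_delta ps.
Proof.
rewrite subr_ge0 truncn_le // /bcp_ratio mulr_ge0 ?invr_ge0 ?exprn_ge0 //; exact: S0.
Qed.

(** [bcp_ratio ps * p ^+ 2] is [S 2]. The quantity is the variance of BCP minus that of the
    indicator sum. *)
Lemma bcp_deltaE : bcp_delta ps * p ^+ 2 = S 2 - M * p ^+ 2.
Proof.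
rewrite /bcp_delta mulrBl; congr (_ - _).
by rewrite /bcp_ratio /p /bcp_p -/S; field; rewrite S20 S30.
Qed.

Lemma bcp_alphaE : bcp_alpha ps = S 1 - M * p.
Proof. by rewrite /bcp_alpha; congr (_ - _); apply: eq_bigr => i _; rewrite expr1. Qed.

(** Nonnegativity of [bcp_delta] gives [M * p ^+ 2 <= S 2], and Cauchy-Schwarz,
    [S 2 ^+ 2 <= S 1 * S 3], gives [S 2 <= S 1 * p]. *)
Lemma bcp_alpha_ge0 : 0 <= bcp_alpha ps.
Proof.
have p0 : 0 < p by case/andP: hp.
have cs : S 2 ^+ 2 <= S 1 * S 3.
  rewrite -subr_ge0 -(pmulr_rge0 _ (_ : 0 < 2)) // (_ : 2 * _ =
    \sum_i \sum_j ps i * ps j * (ps i - ps j) ^+ 2).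
    apply: sumr_ge0 => i _; apply: sumr_ge0 => j _.
    by apply: mulr_ge0 (sqr_ge0 _); exact: mulr_ge0.
  pose e (i j : 'I_n) := ps i ^+ 1 * ps j ^+ 3 - ps i ^+ 2 * ps j ^+ 2.
  have eE : \sum_i \sum_j e i j = S 1 * S 3 - S 2 ^+ 2.
    rewrite expr2 /S /power_sum !big_distrlr -sumrB; apply: eq_bigr => i _.
    by rewrite -sumrB.
  rewrite mulr2n mulrDl mul1r -{1}eE exchange_big /= -eE -big_split.
  apply: eq_bigr => i _ /=; rewrite -big_split; apply: eq_bigr => j _ /=.
  by rewrite /e; ring.
have Mp : M * p ^+ 2 <= S 2.
  by rewrite -subr_ge0 -bcp_deltaE mulr_ge0 ?bcp_delta_ge0 ?sqr_ge0.
rewrite bcp_alphaE subr_ge0 -(ler_pM2r p0) -mulrA -expr2 (le_trans Mp) //.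
rewrite -(ler_pM2r power_sum2_gt0) -mulrA power_sum3E.
by rewrite -expr2.
Qed.

(** The real under the floor is [S 1 / p], which is at least 1 because [p * S 2 = S 3 <= S 1 * S 2],
    each [ps i] being at most [S 1]. *)
Lemma bcp_ThatE : exists2 N : nat, bcp_That ps = N%:Z &
  (0 < N)%N /\ N%:R <= M + bcp_alpha ps / p.
Proof.
have p0 : 0 < p by case/andP: hp.
have -> : M + bcp_alpha ps / p = S 1 / p.
  by rewrite bcp_alphaE; field; rewrite gt_eqF.
have S1 : 1 <= S 1 / p.
  rewrite ler_pdivlMr // mul1r -(ler_pM2r power_sum2_gt0) power_sum3E.
  rewrite mulr_sumr; apply: ler_sum => i _; rewrite exprS ler_wpM2r ?sqr_ge0 //.
  rewrite /S /power_sum (bigD1 i) //= expr1 lerDl sumr_ge0 // => j _.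
  by rewrite expr1.
have -> : bcp_That ps = Num.floor (S 1 / p).
  rewrite /bcp_That bcp_alphaE; congr Num.floor; rewrite -/p -/M.
  by field; rewrite gt_eqF.
have f1 : 1 <= Num.floor (S 1 / p) by rewrite floor_ge_int.
exists `|Num.floor (S 1 / p)|%N; first by rewrite gez0_abs // (le_trans _ f1).
split; first by rewrite -ltz_nat gez0_abs ?(lt_le_trans _ f1) // (le_trans _ f1).
rewrite -[X in X <= _]/((Posz _)%:~R) gez0_abs ?(le_trans _ f1) //.
exact: floor_le.
Qed.

Lemma bcp_tau_ge0 : 0 <= bcp_tau ps.
Proof. exact: bigmax_ge_id. Qed.

Lemma le_bcp_tau i : ps i * (1 - ps i) <= bcp_tau ps.
Proof. exact: le_bigmax. Qed.

End MatchedMoments.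

(** * Assembly of the total variation bound *)

Theorem corollary4p5 (R : realType)
    (d : measure_display) (T : measurableType d) (P : probability T R)
    (n : nat) (ps : 'I_n -> R) (Ind : 'I_n -> {RV P >-> bool})
    (d' : measure_display) (T' : measurableType d') (Q : probability T' R)
    (Y1 Y2 : {RV Q >-> nat})
    (hI : forall i, P [set t | Ind i t = true] = (ps i)%:E)
    (hindep : mutually_independent Ind)
    (hpi : exists i, ps i != 0)
    (hp : 0 < bcp_p ps < 1)
    (* the nat argument of poisson_prob is unused by its definition; for mean 0
       poisson_prob is the Dirac mass at 0 *)
    (hY1 : forall A : set nat,
       distribution Q Y1 A = poisson_prob (bcp_alpha ps) 0 A)
    (hY2 : forall A : set nat,
       distribution Q Y2 A = binomial_prob (bcp_M ps) (bcp_p ps) A)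
    (hY : independent2 Y1 Y2)
    (htheta : bcp_theta2 ps < 1 / 2)
    (hsigma : bcp_sigma2 ps > 3 * bcp_tau ps) :
  let W := indicator_sum Ind in
  let BCP := pushforward Q (sum2 Y1 Y2) in
  let p := bcp_p ps in
  let q := bcp_q ps in
  let That := bcp_That ps in
  (tv_norm (pushforward P W \- BCP)
   <= (2 / (1 - 2 * bcp_theta2 ps))%:E *
      ((4 / (p * q * That%:~R * (bcp_sigma2 ps - 3 * bcp_tau ps)) *
          (\sum_(i < n) ps i ^+ 4 - p * \sum_(i < n) ps i ^+ 3)
        + bcp_delta ps * p ^+ 2)%:E
       + P [set t | (W t > That)%R]
       + Q [set t | (sum2 Y1 Y2 t > That)%R]))%E.
Proof.
cbv zeta; set W := indicator_sum Ind; set p := bcp_p ps.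
have ps01 i : 0 <= ps i <= 1 by exact: (indicator_means01 _ _ _ _ _ _ _ hI).
have /andP[p0 p1] := hp; rewrite -/p in p0 p1.
have q0 : 0 < 1 - p by rewrite subr_gt0.
have [N ThatN [N0 NT]] := bcp_ThatE _ _ _ ps01 hp.
have al0 := bcp_alpha_ge0 _ _ _ ps01 hp.
have d0 : 0 <= bcp_delta ps * p ^+ 2.
  by rewrite mulr_ge0 ?sqr_ge0 ?(bcp_delta_ge0 _ _ _ ps01).
have S20 := power_sum2_gt0 _ _ _ ps01 hp.
have S1E : (bcp_M ps)%:R * p + bcp_alpha ps = power_sum ps 1.
  by rewrite bcp_alphaE addrC subrK.
pose al := bcp_alpha ps; pose m : R := (bcp_M ps)%:R.
pose Y := sum2 Y1 Y2.
have hu i : Q (Y1 @^-1` [set i]) = (poisson_mass al i)%:E.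
  by rewrite -(poisson_prob_set1 _ _ 0) -hY1.
have hv j : Q (Y2 @^-1` [set j]) = (binomial_pmf (bcp_M ps) p j)%:E.
  by rewrite -binomial_prob_set1 -?hY2 // !ltW.
have mW B : measurable (W @^-1` B) by exact: measurable_indicator_sum.
have mY B : measurable (Y @^-1` B) by exact: measurable_sum2.
have W0 t : 0 <= W t by exact: indicator_sum_ge0.
have Y0 t : 0 <= Y t by exact: sum2_ge0.
pose w := point_mass P W; pose y := point_mass Q Y.
have tw0 : 0 <= 1 - \sum_(k < N.+1) w k by exact: tail_ge0.
have ty0 : 0 <= 1 - \sum_(k < N.+1) y k by exact: tail_ge0.
pose v : R := bcp_sigma2 ps - 3 * bcp_tau ps.
have v0 : 0 < v by rewrite subr_gt0.
(* The variance mismatch is tested with the increment bound 2, the third order term with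
   [2 / (p * (1 - p) * N%:R)]. *)
pose B := 2 * (bcp_delta ps * p ^+ 2) + 2 / (p * (1 - p) * N%:R) *
  (4 * (power_sum ps 4 - p * power_sum ps 3) / v).
have := stein_bootstrap R N p m al _ _ B w y hp N0 NT al0 tw0 ty0.
move=> boot; have {boot} hD : (1 - 2 * bcp_theta2 ps) * \sum_(k < N.+1) `|w k - y k|
    <= B + (1 - \sum_(k < N.+1) w k) + (1 - \sum_(k < N.+1) y k).
  rewrite /bcp_theta2 ThatN; apply: boot => [||g gN|g gN gL gK].
  - by rewrite opprB addrC subrK.
  - by rewrite opprB addrC subrK.
  - have sN := stein_op_eq0 _ _ p m al _ gN.
    rewrite (sum_sum2_mass _ _ _ _ _ _ _ _ hu hv hY _ _ sN).
    apply: convolution_stein => // [i|j]; first exact: poisson_mass_rec.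
    exact: binomial_pmf_rec.
  - rewrite (eq_bigr (fun k : 'I_N.+1 =>
      (\prod_i bern (ps i))`_k * stein_op p m al g k)); last first.
      by move=> k _; rewrite /w (indicator_sum_mass _ _ _ _ _ _ _ hI hindep).
    rewrite sum_coef_stein_op // S1E.
    apply: stein_expectation_bound => //.
    + exact: le_bcp_tau.
    + exact: bcp_tau_ge0.
    + exact: power_sum3E.
    + exact: bcp_deltaE.
have th0 : 0 <= bcp_theta2 ps.
  by rewrite /bcp_theta2 ThatN divr_ge0 // mulr_ge0 // ltW.
have c0 : 0 < 1 - 2 * bcp_theta2 ps by move: htheta; lra.
apply: le_trans (tv_norm_le _ _ _ _ _ P Q W Y N mW mY W0 Y0) _.
rewrite ThatN (tailE mW W0) (tailE mY Y0) -!EFinD -EFinM lee_fin -/w -/y.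
set D := \sum_(k < N.+1) _ in hD *.
set tw := 1 - _ in tw0 hD *; set ty := 1 - _ in ty0 hD *.
rewrite [leRHS]mulrAC ler_pdivlMr // mulrC.
have -> : 2 * (4 / (p * bcp_q ps * N%:~R * (bcp_sigma2 ps - 3 * bcp_tau ps)) *
    (\sum_(i < n) ps i ^+ 4 - p * \sum_(i < n) ps i ^+ 3)
    + bcp_delta ps * p ^+ 2 + tw + ty) = B + tw + ty + (tw + ty).
  rewrite /B /bcp_q -/p -/v -/(power_sum ps 4) -/(power_sum ps 3) -[N%:~R]/(N%:R).
  by field; rewrite !gt_eqF // ltr0n.
(* The tails enter twice: once through the masses missing from [[0, N]], once through the points
   outside, where the factor [1 - 2 * bcp_theta2 ps] is at most 1. *)
have := mulr_ge0 th0 (addr_ge0 tw0 ty0); lra.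
Qed.
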